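(* Let $n\ge 4$ be a natural number and let $c\in k$ be arbitrary. Then the algebra $Q(2B)_1^{2,2^{n-2},c}$ has Morita--Frobenius number $1$ if and only if $Q(2B)_1^{2,2^{n-2},c}\cong Q(2B)_1^{2,2^{n-2},\tilde c}$ as $k$-algebras for some $\tilde c\in\mathbb{F}_2$.
   Context: $k\cong\overline{\mathbb{F}}_2$. For integers $s\ge 2$, $t\ge 3$ and $c\in k$, $Q(2B)_1^{s,t,c}$ is the $k$-algebra given by the quiver with two vertices $0,1$, a loop $\alpha$ at $0$, an arrow $\beta$ from $0$ to $1$, an arrow $\gamma$ from $1$ to $0$ and a loop $\eta$ at $1$ (paths are written from left to right, so $\beta\gamma$ is a closed path at $0$), subject to the relations $$\gamma\beta=\eta^{t-1},\quad \beta\eta=(\alpha\beta\gamma)^{s-1}\alpha\beta,\quad \eta\gamma=(\gamma\alpha\beta)^{s-1}\gamma\alpha,\quad \alpha^2=(\beta\gamma\alpha)^{s-1}\beta\gamma+c(\beta\gamma\alpha)^s,\quad \alpha^2\beta=0.$$ The Morita--Frobenius number of a finite-dimensional $k$-algebra $A$ is the smallest $m\ge1$ such that $A$ is Morita equivalent (as a $k$-algebra) to its $m$-th Frobenius twist, i.e. the same ring with the $k$-action twisted by the $m$-th power of the Frobenius automorphism; the first Frobenius twist of $Q(2B)_1^{s,t,c}$ is $Q(2B)_1^{s,t,c^2}$. *)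

(* Defs.v *)
From HB Require Import structures.
From mathcomp Require Import all_boot all_order all_algebra.
From mathcomp Require Import generic_quotient finmap.
From mathcomp Require Import boolp.
From mathcomp Require Import monalg.

Set Implicit Arguments.
Unset Strict Implicit.
Unset Printing Implicit Defensive.

Import GRing.Theory.
Local Open Scope ring_scope.
Local Open Scope quotient_scope.

Record quiver := Quiver {
  vertex : finType;
  arrow : finType;
  source : arrow -> vertex;
  target : arrow -> vertex;
  vertex_nonempty : (0 < #|vertex|)%N
}.

Section Paths.
Variable Q : quiver.

(* Paths are read from left to right: [:: a; b] is "first a, then b". *)
Fixpoint is_walk (v : vertex Q) (p : seq (arrow Q)) : bool :=
  if p is a :: p' then (source a == v) && is_walk (target a) p' else true.

(* A path is its starting vertex together with its sequence of arrows; the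
   starting vertex is needed for the paths of length 0. *)
Record qpath := QPath {
  qpath_val :> vertex Q * seq (arrow Q);
  qpathP : is_walk qpath_val.1 qpath_val.2
}.

HB.instance Definition _ := [isSub for qpath_val].
HB.instance Definition _ := [Choice of qpath by <:].

Definition path_source (x : qpath) : vertex Q := (val x).1.
Definition path_target (x : qpath) : vertex Q :=
  last (path_source x) (map (@target Q) (val x).2).

Lemma is_walk_cat v p q :
  is_walk v (p ++ q) = is_walk v p && is_walk (last v (map (@target Q) p)) q.
Proof. by elim: p v => //= a p IHp v; rewrite IHp andbA. Qed.

Definition path_cat (x y : qpath) : option qpath :=
  if path_target x == path_source y
  then insub (path_source x, (val x).2 ++ (val y).2) else None.

Definition trivial_path (v : vertex Q) : qpath :=
  @QPath (v, [::]) isT.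

Lemma arrow_pathP (a : arrow Q) : is_walk (source a) [:: a].
Proof. by rewrite /= eqxx. Qed.

Definition arrow_path (a : arrow Q) : qpath :=
  @QPath (source a, [:: a]) (arrow_pathP a).

Lemma path_catE x y : path_target x = path_source y ->
  exists z, [/\ path_cat x y = Some z, path_source z = path_source x,
    path_target z = path_target y & (val z).2 = (val x).2 ++ (val y).2].
Proof.
move=> exy; rewrite /path_cat exy eqxx.
have w : is_walk (path_source x) ((val x).2 ++ (val y).2).
  rewrite is_walk_cat (valP x) /=.
  by have := valP y; rewrite -/(path_source y) -exy.
exists (@QPath (path_source x, (val x).2 ++ (val y).2) w); split=> //.
  by rewrite insubT; congr Some; apply: val_inj.
by rewrite /path_target /= map_cat last_cat; congr (last _ _).
Qed.

Lemma path_catN x y : path_target x <> path_source y -> path_cat x y = None.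
Proof. by move/eqP/negPf=> nxy; rewrite /path_cat nxy. Qed.

Lemma qpath_eq (x y : qpath) : path_source x = path_source y ->
  (val x).2 = (val y).2 -> x = y.
Proof.
move=> e1 e2; apply: val_inj; move: e1 e2; rewrite /path_source.
by case: (val x) (val y) => [? ?] [? ?] /= -> ->.
Qed.

Lemma path_catA x y z :
  obind (path_cat x) (path_cat y z) = obind (path_cat^~ z) (path_cat x y).
Proof.
have [exy|nxy] := eqVneq (path_target x) (path_source y); last first.
  rewrite (path_catN (elimN eqP nxy)) /=.
  have [eyz|nyz] := eqVneq (path_target y) (path_source z).
    have [u [-> su _ _]] := path_catE eyz.
    by rewrite /= path_catN // su; apply/eqP.
  by rewrite (path_catN (elimN eqP nyz)).
have [u [-> su tu pu]] := path_catE exy.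
have [eyz|nyz] := eqVneq (path_target y) (path_source z); last first.
  by rewrite (path_catN (elimN eqP nyz)) /= path_catN // tu; apply/eqP.
have [v [-> sv tv pv]] := path_catE eyz => /=.
have [|w [-> sw _ pw]] := @path_catE x v; first by rewrite sv.
have [|w' [-> sw' _ pw']] := @path_catE u z; first by rewrite tu.
congr Some; apply: qpath_eq; first by rewrite sw sw'.
by rewrite pw pw' pu pv catA.
Qed.

Lemma path_cat1 v y :
  path_cat (trivial_path v) y = if v == path_source y then Some y else None.
Proof.
case: eqP => [e|n]; last by apply: path_catN.
have [z [-> sz _ pz]] := @path_catE (trivial_path v) y e.
by congr Some; apply: qpath_eq; rewrite ?sz ?pz //= -e.
Qed.

Lemma path_cat_1 x v :
  path_cat x (trivial_path v) = if v == path_target x then Some x else None.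
Proof.
rewrite eq_sym; case: eqP => [e|n]; last by apply: path_catN.
have [z [-> sz _ pz]] := @path_catE x (trivial_path v) e.
by congr Some; apply: qpath_eq; rewrite // pz cats0.
Qed.

Lemma path_cat_trivial x y v : (path_cat x y == Some (trivial_path v)) =
  (x == trivial_path v) && (y == trivial_path v).
Proof.
apply/eqP/andP => [exy|[/eqP-> /eqP->]]; last by rewrite path_cat1 eqxx.
have [e|/eqP n] := eqVneq (path_target x) (path_source y); last first.
  by rewrite path_catN in exy.
have [z [ez sz tz pz]] := path_catE e.
move: ez; rewrite exy => -[ez]; rewrite -{}ez /= in sz tz pz.
have [px py] : (val x).2 = [::] /\ (val y).2 = [::].
  by case: (val x).2 pz => // _; case: (val y).2.
have sx : path_source x = v by rewrite -sz.
split; apply/eqP/qpath_eq => //.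
by rewrite -e /path_target px sx.
Qed.

End Paths.

Definition path_algebra (R : comNzRingType) (Q : quiver) : Type :=
  {malg R[qpath Q]}.

(* Locked, since unfolding finitely supported functions makes unification
   very slow. *)
HB.lock Definition path_elt (R : comNzRingType) (Q : quiver) (x : qpath Q) :
  path_algebra R Q := << x >>.

Section PathAlgebra.
Variables (R : comNzRingType) (Q : quiver).
Local Notation A := (path_algebra R Q).
Local Notation P := (qpath Q).

HB.instance Definition _ := GRing.Lmodule.on A.

Local Notation path_elt := (@path_elt R Q).

Lemma path_elt_coef x y : (path_elt x)@_y = (x == y)%:R.
Proof. by rewrite path_elt.unlock mcoeffU. Qed.

Definition linear_extension (V : lmodType R) (h : P -> V) (f : A) : V :=
  \sum_(x <- msupp f) f@_x *: h x.

Definition path_mul (x y : P) : A :=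
  if path_cat x y is Some z then path_elt z else 0.

Definition pa_mul (f g : A) : A :=
  linear_extension (fun x => linear_extension (path_mul x) g) f.

Definition pa_one : A := \sum_(v : vertex Q) path_elt (trivial_path v).

Lemma lextEw (V : lmodType R) (h : P -> V) (f : A) (d : {fset P}) :
  (msupp f `<=` d)%fset ->
  linear_extension h f = \sum_(x <- d) f@_x *: h x.
Proof.
move=> sd; rewrite /linear_extension (big_fset_incl _ sd) //= => x _.
by move/mcoeff_outdom=> ->; rewrite scale0r.
Qed.

Lemma lext_is_linear (V : lmodType R) (h : P -> V) :
  linear (linear_extension h).
Proof.
move=> a f g; set d := (msupp (a *: f + g) `|` (msupp f `|` msupp g))%fset.
rewrite (@lextEw _ h (a *: f + g) d); last exact: fsubsetUl.
rewrite (@lextEw _ h f d); last first.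
  by apply: fsubset_trans (fsubsetUr _ _); exact: fsubsetUl.
rewrite (@lextEw _ h g d); last first.
  by apply: fsubset_trans (fsubsetUr _ _); exact: fsubsetUr.
rewrite scaler_sumr -big_split /=; apply: eq_bigr => x _.
by rewrite mcoeffD mcoeffZ scalerDl scalerA.
Qed.

HB.instance Definition _ (V : lmodType R) (h : P -> V) :=
  GRing.isLinear.Build R A V _ (linear_extension h) (lext_is_linear h).

Lemma lextU (V : lmodType R) (h : P -> V) x :
  linear_extension h (path_elt x) = h x.
Proof.
by rewrite path_elt.unlock (@lextEw _ h _ [fset x]%fset) ?msuppU_le // big_seq_fset1 mcoeffUU scale1r.
Qed.

Lemma pa_decomp (f : A) : f = \sum_(x <- msupp f) f@_x *: path_elt x.
Proof.
rewrite {1}[f]monalgE; apply: eq_bigr => x _.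
apply/malgP=> y; rewrite mcoeffZ [LHS]mcoeffU path_elt_coef.
by rewrite mulr_natr.
Qed.

Lemma pa_mulE (f g : A) :
  pa_mul f g = \sum_(x <- msupp f) f@_x *: linear_extension (path_mul x) g.
Proof. by []. Qed.



Lemma lin_ext_eq (V : lmodType R) (F G : {linear A -> V}) :
  (forall x, F (path_elt x) = G (path_elt x)) -> F =1 G.
Proof.
move=> e f; rewrite [f]pa_decomp !linear_sum; apply: eq_bigr => x _.
by rewrite !linearZ_LR /= e.
Qed.

Lemma pa_mul_linl g : linear (pa_mul^~ g).
Proof. by move=> a f f'; rewrite /pa_mul linearP. Qed.

Lemma pa_mul_linr f : linear (pa_mul f).
Proof.
move=> a g g'; rewrite !pa_mulE.
rewrite scaler_sumr -big_split /=; apply: eq_bigr => x _.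
by rewrite linearP scalerDr !scalerA mulrC.
Qed.

HB.instance Definition _ f :=
  GRing.isLinear.Build R A A _ (pa_mul f) (pa_mul_linr f).
Definition pa_mulr g f := pa_mul f g.
HB.instance Definition _ g :=
  GRing.isLinear.Build R A A _ (pa_mulr g) (pa_mul_linl g).

Lemma pa_mulU x y : pa_mul (path_elt x) (path_elt y) = path_mul x y.
Proof. by rewrite /pa_mul !lextU. Qed.


Lemma pa_mul0l g : pa_mul 0 g = 0.
Proof. exact: (linear0 (pa_mulr g)). Qed.

Lemma pa_mul0r f : pa_mul f 0 = 0.
Proof. exact: (linear0 (pa_mul f)). Qed.

Lemma pa_mulA : associative pa_mul.
Proof.
move=> f g h.
apply: (lin_ext_eq (F := pa_mulr (pa_mul g h)) (G := pa_mulr h \o pa_mulr g)).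
move=> x /=; rewrite /pa_mulr {f}.
apply: (lin_ext_eq (F := pa_mul (path_elt x) \o pa_mulr h)
   (G := pa_mulr h \o pa_mul (path_elt x))).
move=> y /=; rewrite /pa_mulr {g}.
apply: (lin_ext_eq (F := pa_mul (path_elt x) \o pa_mul (path_elt y))
   (G := pa_mul (pa_mul (path_elt x) (path_elt y)))).
move=> z /=; rewrite (pa_mulU y z) (pa_mulU x y) {h} /path_mul.
have := path_catA x y z.
case: (path_cat y z) => [u|] /=; case: (path_cat x y) => [v|] /= e.
- by rewrite (pa_mulU x u) (pa_mulU v z) /path_mul e.
- by rewrite (pa_mulU x u) pa_mul0l /path_mul e.
- by rewrite (pa_mulU v z) pa_mul0r /path_mul -e.
- by rewrite pa_mul0l pa_mul0r.
Qed.

Lemma pa_mul1 : left_id pa_one pa_mul.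
Proof.
move=> f; apply: (lin_ext_eq (F := pa_mul pa_one) (G := idfun)) => x /= {f}.
rewrite -[pa_mul _ _]/(pa_mulr _ _) linear_sum /= (bigD1 (path_source x)) //=.
rewrite big1 => [|v /negPf nv].
  by rewrite addr0 /pa_mulr pa_mulU /path_mul path_cat1 eqxx.
by rewrite /pa_mulr pa_mulU /path_mul path_cat1 nv.
Qed.

Lemma pa_mul_1 : right_id pa_one pa_mul.
Proof.
move=> f; apply: (lin_ext_eq (F := pa_mulr pa_one) (G := idfun)) => x /= {f}.
rewrite /pa_mulr linear_sum /= (bigD1 (path_target x)) //=.
rewrite big1 => [|v /negPf nv].
  by rewrite addr0 pa_mulU /path_mul path_cat_1 eqxx.
by rewrite pa_mulU /path_mul path_cat_1 nv.
Qed.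

Lemma pa_mulDl : left_distributive pa_mul +%R.
Proof. by move=> f g h; exact: (linearD (pa_mulr h)). Qed.

Lemma pa_mulDr : right_distributive pa_mul +%R.
Proof. by move=> f g h; exact: linearD. Qed.

Lemma pa_coef_one v : pa_one@_(trivial_path v) = 1.
Proof.
rewrite /pa_one raddf_sum /= (bigD1 v) //= path_elt_coef eqxx big1 ?addr0 // => w.
by move=> /negPf nw; rewrite path_elt_coef -val_eqE /= xpair_eqE nw.
Qed.

Lemma pa_one_neq0 : pa_one != 0.
Proof.
have /card_gt0P[v _] := vertex_nonempty Q.
apply/eqP => /(congr1 (mcoeff (trivial_path v))).
by rewrite pa_coef_one mcoeff0 => /eqP; rewrite oner_eq0.
Qed.

HB.instance Definition _ := GRing.Zmodule_isNzRing.Build A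
  pa_mulA pa_mul1 pa_mul_1 pa_mulDl pa_mulDr pa_one_neq0.

Lemma pa_scaleAl (a : R) (f g : A) : a *: (f * g) = (a *: f) * g.
Proof. by rewrite -[RHS]/(pa_mulr g (a *: f)) linearZ. Qed.

Lemma pa_scaleAr (a : R) (f g : A) : a *: (f * g) = f * (a *: g).
Proof. by rewrite -[RHS]/(pa_mul f (a *: g)) linearZ. Qed.

HB.instance Definition _ := GRing.Lmodule_isLalgebra.Build R A pa_scaleAl.
HB.instance Definition _ := GRing.Lalgebra_isAlgebra.Build R A pa_scaleAr.

Definition coef_mul v (c : R) (f : A) : R^o := (f@_(trivial_path v) * c : R).

Lemma coef_mul_is_linear v c : linear (coef_mul v c).
Proof.
by move=> a f g; rewrite /coef_mul mcoeffD mcoeffZ mulrDl -mulrA.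
Qed.

HB.instance Definition _ v c :=
  GRing.isLinear.Build R A R^o _ (coef_mul v c) (coef_mul_is_linear v c).

Lemma pa_coef_trivialM v (f g : A) :
  (f * g)@_(trivial_path v) = f@_(trivial_path v) * g@_(trivial_path v).
Proof.
have basis_l x : coef_mul v 1 \o pa_mul (path_elt x)
                 =1 coef_mul v (path_elt x)@_(trivial_path v).
  apply: lin_ext_eq => y.
  rewrite [LHS]/= [RHS]/= (pa_mulU x y) /path_mul /coef_mul mulr1 !path_elt_coef.
  rewrite mulrC -natrM mulnb -path_cat_trivial.
  by case: (path_cat x y) => [z|] /=; rewrite ?path_elt_coef ?mcoeff0.
have basis_r : coef_mul v 1 \o pa_mulr g =1 coef_mul v g@_(trivial_path v).
  apply: lin_ext_eq => x; rewrite [LHS](basis_l x g); exact: mulrC.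
have := basis_r f; rewrite /coef_mul [LHS]/= mulr1; exact.
Qed.

Definition vertex_coef v (f : A) : R := f@_(trivial_path v).

Lemma vertex_coef_is_additive v : zmod_morphism (vertex_coef v).
Proof. exact: (raddfB (mcoeff (trivial_path v))). Qed.
Lemma vertex_coef_is_multiplicative v : monoid_morphism (vertex_coef v).
Proof. by split; [exact: pa_coef_one | exact: pa_coef_trivialM]. Qed.

HB.instance Definition _ v :=
  GRing.isZmodMorphism.Build A R (vertex_coef v) (vertex_coef_is_additive v).
HB.instance Definition _ v :=
  GRing.isMonoidMorphism.Build A R (vertex_coef v)
    (vertex_coef_is_multiplicative v).

Lemma vertex_coefZ v a f : vertex_coef v (a *: f) = a * vertex_coef v f.
Proof. exact: mcoeffZ. Qed.

Lemma vertex_coef_arrow v a : vertex_coef v (path_elt (arrow_path a)) = 0.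
Proof.
by rewrite /vertex_coef path_elt_coef -val_eqE /= xpair_eqE andbF.
Qed.

End PathAlgebra.

Section IdealQuotient.
Variables (R : comNzRingType) (A : algType R).

Record proper_twosided_ideal := ProperTwosidedIdeal {
  in_ideal :> A -> Prop;
  in_ideal0 : in_ideal 0;
  in_idealD : forall x y, in_ideal x -> in_ideal y -> in_ideal (x + y);
  in_idealMl : forall a x, in_ideal x -> in_ideal (a * x);
  in_idealMr : forall a x, in_ideal x -> in_ideal (x * a);
  in_ideal1 : ~ in_ideal 1
}.

Inductive generated_ideal (S : A -> Prop) : A -> Prop :=
| gen_in x : S x -> generated_ideal S x
| gen0 : generated_ideal S 0
| genD x y : generated_ideal S x -> generated_ideal S y ->
    generated_ideal S (x + y)
| genMl a x : generated_ideal S x -> generated_ideal S (a * x)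
| genMr a x : generated_ideal S x -> generated_ideal S (x * a).

Variable I : proper_twosided_ideal.

Definition ideal_eqv (x y : A) : bool := `[< I (x - y) >].

Lemma in_idealN x : I x -> I (- x).
Proof. by move=> Ix; rewrite -mulN1r; apply: in_idealMl. Qed.

Lemma ideal_eqv_refl : reflexive ideal_eqv.
Proof. by move=> x; apply/asboolP; rewrite subrr; apply: in_ideal0. Qed.
Lemma ideal_eqv_sym : symmetric ideal_eqv.
Proof.
by move=> x y; apply/asboolP/asboolP => /in_idealN; rewrite opprB.
Qed.
Lemma ideal_eqv_trans : transitive ideal_eqv.
Proof.
move=> y x z /asboolP Ixy /asboolP Iyz; apply/asboolP.
by rewrite -(subrKA y); apply: in_idealD.
Qed.

Canonical ideal_equiv :=
  EquivRel ideal_eqv ideal_eqv_refl ideal_eqv_sym ideal_eqv_trans.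

Definition quotient_algebra := {eq_quot ideal_equiv}.
Local Notation B := quotient_algebra.
HB.instance Definition _ := Choice.on B.
HB.instance Definition _ := EqQuotient.on B.

Lemma quot_eqP (x y : A) : (\pi_B x = \pi_B y) <-> I (x - y).
Proof.
by split=> [/eqmodP/asboolP|h]; [|apply/eqmodP/asboolP].
Qed.

Definition quot_zero : B := \pi_B 0.
Definition quot_one : B := \pi_B 1.
Definition quot_opp (x : B) : B := locked (\pi_B (- repr x)).
Definition quot_add (x y : B) : B := locked (\pi_B (repr x + repr y)).
Definition quot_mul (x y : B) : B := locked (\pi_B (repr x * repr y)).
Definition quot_scale (a : R) (x : B) : B := locked (\pi_B (a *: repr x)).

Lemma repr_pi x : I (repr (\pi_B x) - x).
Proof. by apply/quot_eqP; rewrite reprK. Qed.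

Lemma in_idealZ a x : I x -> I (a *: x).
Proof. by move=> Ix; rewrite -mulr_algl; apply: in_idealMl. Qed.

Lemma quot_oppE x : quot_opp (\pi_B x) = \pi_B (- x).
Proof. by rewrite /quot_opp -lock; apply/quot_eqP; rewrite -opprD; apply/in_idealN/repr_pi. Qed.
Lemma quot_addE x y : quot_add (\pi_B x) (\pi_B y) = \pi_B (x + y).
Proof. by rewrite /quot_add -lock; apply/quot_eqP; rewrite opprD addrACA; apply: in_idealD; apply: repr_pi. Qed.
Lemma quot_mulE x y : quot_mul (\pi_B x) (\pi_B y) = \pi_B (x * y).
Proof.
rewrite /quot_mul -lock; apply/quot_eqP; set x' := repr _; set y' := repr _.
have -> : x' * y' - x * y = (x' - x) * y' + x * (y' - y).
  by rewrite mulrBl mulrBr addrA subrK.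
by apply: in_idealD; [apply: in_idealMr|apply: in_idealMl]; apply: repr_pi.
Qed.
Lemma quot_scaleE a x : quot_scale a (\pi_B x) = \pi_B (a *: x).
Proof. by rewrite /quot_scale -lock; apply/quot_eqP; rewrite -scalerBr; apply/in_idealZ/repr_pi. Qed.

Definition quotE := (quot_oppE, quot_addE, quot_mulE, quot_scaleE).


Lemma quot_addA : associative quot_add.
Proof. by move=> x y z; rewrite -[x]reprK -[y]reprK -[z]reprK !quotE addrA. Qed.
Lemma quot_addC : commutative quot_add.
Proof. by move=> x y; rewrite -[x]reprK -[y]reprK !quotE addrC. Qed.
Lemma quot_add0 : left_id quot_zero quot_add.
Proof. by move=> x; rewrite -[x]reprK !quotE add0r. Qed.
Lemma quot_addN : left_inverse quot_zero quot_opp quot_add.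
Proof. by move=> x; rewrite -[x]reprK !quotE addNr. Qed.
HB.instance Definition _ :=
  GRing.isZmodule.Build B quot_addA quot_addC quot_add0 quot_addN.

Lemma quot_mulA : associative quot_mul.
Proof. by move=> x y z; rewrite -[x]reprK -[y]reprK -[z]reprK !quotE mulrA. Qed.
Lemma quot_mul1 : left_id quot_one quot_mul.
Proof. by move=> x; rewrite -[x]reprK !quotE mul1r. Qed.
Lemma quot_mul_1 : right_id quot_one quot_mul.
Proof. by move=> x; rewrite -[x]reprK !quotE mulr1. Qed.
Lemma quot_mulDl : left_distributive quot_mul quot_add.
Proof. by move=> x y z; rewrite -[x]reprK -[y]reprK -[z]reprK !quotE mulrDl. Qed.
Lemma quot_mulDr : right_distributive quot_mul quot_add.
Proof. by move=> x y z; rewrite -[x]reprK -[y]reprK -[z]reprK !quotE mulrDr. Qed.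
Lemma quot_one_neq0 : quot_one != quot_zero.
Proof. by apply/eqP=> /quot_eqP; rewrite subr0; apply: in_ideal1. Qed.
HB.instance Definition _ := GRing.Zmodule_isNzRing.Build B
  quot_mulA quot_mul1 quot_mul_1 quot_mulDl quot_mulDr quot_one_neq0.

Lemma quot_scaleA a b x : quot_scale a (quot_scale b x) = quot_scale (a * b) x.
Proof. by rewrite -[x]reprK !quotE scalerA. Qed.
Lemma quot_scale1 : left_id 1 quot_scale.
Proof. by move=> x; rewrite -[x]reprK !quotE scale1r. Qed.
Lemma quot_scaleDr : right_distributive quot_scale +%R.
Proof.
move=> a x y; rewrite -[x + y]/(quot_add _ _) -[RHS]/(quot_add _ _).
by rewrite -[x]reprK -[y]reprK !quotE scalerDr.
Qed.
Lemma quot_scaleDl x : {morph quot_scale^~ x : a b / a + b}.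
Proof.
by move=> a b /=; rewrite -[RHS]/(quot_add _ _) -[x]reprK !quotE scalerDl.
Qed.
HB.instance Definition _ := GRing.Zmodule_isLmodule.Build R B
  quot_scaleA quot_scale1 quot_scaleDr quot_scaleDl.

Lemma quot_scaleAl (a : R) (x y : B) : a *: (x * y) = (a *: x) * y.
Proof.
rewrite -[LHS]/(quot_scale _ (quot_mul _ _)).
rewrite -[RHS]/(quot_mul (quot_scale _ _) _).
by rewrite -[x]reprK -[y]reprK !quotE scalerAl.
Qed.
Lemma quot_scaleAr (a : R) (x y : B) : a *: (x * y) = x * (a *: y).
Proof.
rewrite -[LHS]/(quot_scale _ (quot_mul _ _)).
rewrite -[RHS]/(quot_mul _ (quot_scale _ _)).
by rewrite -[x]reprK -[y]reprK !quotE scalerAr.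
Qed.
HB.instance Definition _ := GRing.Lmodule_isLalgebra.Build R B quot_scaleAl.
HB.instance Definition _ := GRing.Lalgebra_isAlgebra.Build R B quot_scaleAr.

End IdealQuotient.

Variant arrow2B := Alpha | Beta | Gamma | Eta.

Definition arrow2B_code (a : arrow2B) : 'I_4 :=
  match a with
  | Alpha => inord 0 | Beta => inord 1 | Gamma => inord 2 | Eta => inord 3
  end.
Definition arrow2B_decode (i : 'I_4) : arrow2B :=
  match val i with 0 => Alpha | 1 => Beta | 2 => Gamma | _ => Eta end%N.
Lemma arrow2B_codeK : cancel arrow2B_code arrow2B_decode.
Proof. by case; rewrite /arrow2B_decode /= inordK. Qed.
HB.instance Definition _ := Finite.copy arrow2B (can_type arrow2B_codeK).

Definition vertex0 : 'I_2 := ord0.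
Definition vertex1 : 'I_2 := ord_max.

Definition source2B (a : arrow2B) : 'I_2 :=
  match a with
  | Alpha => vertex0 | Beta => vertex0 | Gamma => vertex1 | Eta => vertex1
  end.
Definition target2B (a : arrow2B) : 'I_2 :=
  match a with
  | Alpha => vertex0 | Beta => vertex1 | Gamma => vertex0 | Eta => vertex1
  end.

Lemma vertices2B_nonempty : (0 < #|'I_2|)%N.
Proof. by rewrite card_ord. Qed.

Definition quiver2B : quiver := Quiver source2B target2B vertices2B_nonempty.

Section Q2B.
Variables (k : fieldType) (s t : nat).
Local Notation kQ := (path_algebra k quiver2B).

Definition alpha2B : kQ := path_elt k (arrow_path (Q := quiver2B) Alpha).
Definition beta2B : kQ := path_elt k (arrow_path (Q := quiver2B) Beta).
Definition gamma2B : kQ := path_elt k (arrow_path (Q := quiver2B) Gamma).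
Definition eta2B : kQ := path_elt k (arrow_path (Q := quiver2B) Eta).
Local Notation alpha := alpha2B.
Local Notation beta := beta2B.
Local Notation gamma := gamma2B.
Local Notation eta := eta2B.

(* Each relation u = v of the quiver is encoded by its relator u - v. *)
Variant relator2B (c : k) : kQ -> Prop :=
| rel_gamma_beta : relator2B c (gamma * beta - eta ^+ (t - 1))
| rel_beta_eta : relator2B c
    (beta * eta - (alpha * beta * gamma) ^+ (s - 1) * alpha * beta)
| rel_eta_gamma : relator2B c
    (eta * gamma - (gamma * alpha * beta) ^+ (s - 1) * gamma * alpha)
| rel_alpha2 : relator2B c
    (alpha ^+ 2 - ((beta * gamma * alpha) ^+ (s - 1) * beta * gamma
                   + c *: (beta * gamma * alpha) ^+ s))
| rel_alpha2_beta : relator2B c (alpha ^+ 2 * beta).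

(* The bounds on s and t put every relator in the square of the arrow ideal,
   so that the quotient is not the zero ring. *)
Hypotheses (hs : (2 <= s)%N) (ht : (3 <= t)%N).

Lemma ideal2B_coef c w : generated_ideal (relator2B c) w ->
  vertex_coef (vertex0 : vertex quiver2B) w = 0.
Proof.
set v0 := (vertex0 : vertex quiver2B).
have arr a : vertex_coef v0
    (path_elt k (arrow_path (Q := quiver2B) a)) = 0.
  exact: vertex_coef_arrow.
have kD x y : vertex_coef v0 x = 0 -> vertex_coef v0 y = 0 ->
    vertex_coef v0 (x + y) = 0.
  by move=> hx hy; rewrite raddfD /= hx hy addr0.
have kZ a x : vertex_coef v0 x = 0 -> vertex_coef v0 (a *: x) = 0.
  by move=> hx; rewrite vertex_coefZ hx mulr0.
have kB x y : vertex_coef v0 x = 0 -> vertex_coef v0 y = 0 ->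
    vertex_coef v0 (x - y) = 0.
  by move=> hx hy; rewrite raddfB /= hx hy subr0.
have kMl x y : vertex_coef v0 y = 0 -> vertex_coef v0 (x * y) = 0.
  by move=> hy; rewrite (rmorphM (vertex_coef v0)) /= hy mulr0.
have kMr x y : vertex_coef v0 x = 0 -> vertex_coef v0 (x * y) = 0.
  by move=> hx; rewrite (rmorphM (vertex_coef v0)) /= hx mul0r.
have kX x n : (0 < n)%N -> vertex_coef v0 x = 0 -> vertex_coef v0 (x ^+ n) = 0.
  by case: n => // n _ hx; rewrite exprS; apply: kMr.
have t1 : (0 < t - 1)%N by rewrite subn_gt0; apply: leq_trans ht.
have s0 : (0 < s)%N by apply: leq_trans hs.
elim=> {w} [w||x y _ IHx _ IHy|a x _ IH|a x _ IH].
- case.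
  + by apply: kB; [apply: kMl (arr _) | apply: kX t1 (arr _)].
  + by apply: kB; apply: kMl (arr _).
  + by apply: kB; apply: kMl (arr _).
  + apply: kB; first by apply: kX (arr _).
    apply: kD; first by apply: kMl (arr _).
    by apply: kZ; apply: kX s0 _; apply: kMl (arr _).
  + by apply: kMl (arr _).
- exact: raddf0.
- exact: kD.
- exact: kMl.
- exact: kMr.
Qed.

Lemma ideal2B_proper c : ~ generated_ideal (relator2B c) 1.
Proof. by move/ideal2B_coef/eqP; rewrite rmorph1 oner_eq0. Qed.

Definition ideal2B (c : k) : proper_twosided_ideal kQ :=
  ProperTwosidedIdeal (@gen0 _ _ (relator2B c)) (@genD _ _ (relator2B c))
    (@genMl _ _ (relator2B c)) (@genMr _ _ (relator2B c)) (@ideal2B_proper c).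

Definition Q2B (c : k) : algType k := quotient_algebra (ideal2B c).

End Q2B.

Arguments Q2B : clear implicits.

Definition algebra_isomorphic (k : fieldType) (A B : algType k) : Prop :=
  exists f : {lrmorphism A -> B}, bijective f.

Section Morita.
Variable k : fieldType.

(* Left modules are used; Morita equivalence does not depend on the side.
   The k-linear structure on Hom_A(M, N) comes from the action of a : k on N
   through the central element a%:A of A. *)
Record linear_functor (A B : algType k) := LinearFunctor {
  fobj :> lmodType A -> lmodType B;
  fmap : forall M N : lmodType A, {linear M -> N} -> {linear fobj M -> fobj N};
  fmap_id : forall (M : lmodType A) (f : {linear M -> M}),
    f =1 id -> fmap f =1 id;
  fmap_comp : forall (L M N : lmodType A) (f : {linear L -> M})
    (g : {linear M -> N}) (h : {linear L -> N}),
    h =1 g \o f -> fmap h =1 fmap g \o fmap f;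
  fmap_linear : forall (M N : lmodType A) (a : k) (f g h : {linear M -> N}),
    (forall x, h x = (a%:A : A) *: f x + g x) ->
    forall y, fmap h y = (a%:A : B) *: fmap f y + fmap g y
}.

Definition left_quasi_inverse (A B : algType k)
    (F : linear_functor A B) (G : linear_functor B A) : Prop :=
  exists eps : forall M : lmodType A, {linear G (F M) -> M},
    (forall M, bijective (eps M)) /\
    (forall (M N : lmodType A) (f : {linear M -> N}) x,
       eps N (fmap G (fmap F f) x) = f (eps M x)).

Definition morita_equivalent (A B : algType k) : Prop :=
  exists (F : linear_functor A B) (G : linear_functor B A),
    left_quasi_inverse F G /\ left_quasi_inverse G F.

End Morita.

Section FrobeniusTwist.
Variables (k : closedFieldType) (p : nat) (chark : p \in [pchar k]).

Lemma frobenius_root_subproof (m : nat) (a : k) :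
  exists b : k, b ^+ (p ^ m) == a.
Proof.
have pm_gt0 : (0 < p ^ m)%N.
  by rewrite expn_gt0 prime_gt0 // (pcharf_prime chark).
have [b eb] := solve_monicpoly (fun i => if i == 0%N then a else 0) pm_gt0.
exists b; rewrite eb; case: (p ^ m)%N pm_gt0 => // q _.
by rewrite big_ord_recl /= expr0 mulr1 big1 ?addr0 // => i _; rewrite mul0r.
Qed.

Definition frobenius_root (m : nat) (a : k) : k :=
  xchoose (frobenius_root_subproof m a).

Lemma frobenius_rootK m a : frobenius_root m a ^+ (p ^ m) = a.
Proof. exact/eqP/(xchooseP (frobenius_root_subproof m a)). Qed.

Lemma frobenius_powD m (a b : k) :
  (a + b) ^+ (p ^ m) = a ^+ (p ^ m) + b ^+ (p ^ m).
Proof.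
apply: exprDn_pchar; rewrite (eq_pnat _ (pcharf_eq chark)).
by rewrite pnatX pnat_id ?(pcharf_prime chark).
Qed.

Lemma frobenius_pow_inj m : injective (fun a : k => a ^+ (p ^ m)).
Proof.
move=> a b /= eab; apply/eqP; rewrite -subr_eq0; apply/eqP.
have := frobenius_powD m (a - b) b; rewrite subrK eab -[LHS]add0r.
by move/addIr/esym/eqP; rewrite expf_eq0 => /andP[_ /eqP].
Qed.

Lemma frobenius_root1 m : frobenius_root m 1 = 1.
Proof. by apply: (@frobenius_pow_inj m); rewrite frobenius_rootK expr1n. Qed.

Lemma frobenius_rootD m a b :
  frobenius_root m (a + b) = frobenius_root m a + frobenius_root m b.
Proof.
by apply: (@frobenius_pow_inj m); rewrite frobenius_powD !frobenius_rootK.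
Qed.

Lemma frobenius_rootM m a b :
  frobenius_root m (a * b) = frobenius_root m a * frobenius_root m b.
Proof. by apply: (@frobenius_pow_inj m); rewrite exprMn !frobenius_rootK. Qed.

End FrobeniusTwist.

(* The m-th Frobenius twist is the ring A on which a : k acts as the (p ^ m)-th
   root of a does on A. Acting through the root, rather than the power, makes
   the relations of the twist those of A with the m-th power of Frobenius
   applied to their coefficients. *)
Definition frobenius_twist (k : closedFieldType) (p : nat)
  (chark : p \in [pchar k]) (m : nat) (A : algType k) : Type := A.

Section TwistAlgebra.
Variables (k : closedFieldType) (p : nat) (chark : p \in [pchar k]).
Variables (m : nat) (A : algType k).
Local Notation T := (frobenius_twist chark m A).

HB.instance Definition _ := GRing.NzRing.on T.

Definition twist_scale (a : k) (x : T) : T :=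
  frobenius_root chark m a *: (x : A).

Lemma twist_scaleA a b x : twist_scale a (twist_scale b x) = twist_scale (a * b) x.
Proof. by rewrite /twist_scale scalerA frobenius_rootM. Qed.
Lemma twist_scale1 : left_id 1 twist_scale.
Proof. by move=> x; rewrite /twist_scale frobenius_root1 scale1r. Qed.
Lemma twist_scaleDr : right_distributive twist_scale +%R.
Proof. by move=> a x y; rewrite /twist_scale scalerDr. Qed.
Lemma twist_scaleDl x : {morph twist_scale^~ x : a b / a + b}.
Proof. by move=> a b; rewrite /twist_scale frobenius_rootD scalerDl. Qed.

HB.instance Definition _ := GRing.Zmodule_isLmodule.Build k T
  twist_scaleA twist_scale1 twist_scaleDr twist_scaleDl.

Lemma twist_scaleAl (a : k) (x y : T) : a *: (x * y) = (a *: x) * y.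
Proof. exact: (scalerAl (frobenius_root chark m a) (x : A) y). Qed.
Lemma twist_scaleAr (a : k) (x y : T) : a *: (x * y) = x * (a *: y).
Proof. exact: (scalerAr (frobenius_root chark m a) (x : A) y). Qed.

HB.instance Definition _ := GRing.Lmodule_isLalgebra.Build k T twist_scaleAl.
HB.instance Definition _ := GRing.Lalgebra_isAlgebra.Build k T twist_scaleAr.

End TwistAlgebra.

Definition is_morita_frobenius_number (k : closedFieldType) (p : nat)
    (chark : p \in [pchar k]) (A : algType k) (m : nat) : Prop :=
  [/\ (1 <= m)%N,
      morita_equivalent A (frobenius_twist chark m A) &
      forall j, (1 <= j < m)%N ->
        ~ morita_equivalent A (frobenius_twist chark j A)].

Lemma pchar2_of_F2 (k : closedFieldType) (iota : {rmorphism 'F_2 -> k}) :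
  2%N \in [pchar k].
Proof. by rewrite (fmorph_pchar iota) pchar_Fp. Qed.

Lemma exp2_sub2_ge3 n : (4 <= n)%N -> (3 <= 2 ^ (n - 2))%N.
Proof.
move=> hn; apply: (@leq_trans (2 ^ 2)) => //; rewrite leq_pexp2l //.
by rewrite leq_subRL // (leq_trans _ hn).
Qed.

(* Main.v *)
Require Import Defs.
From HB Require Import structures.
From mathcomp Require Import all_boot all_order all_algebra.
From mathcomp Require Import generic_quotient finmap monalg ring.

Set Implicit Arguments.
Unset Strict Implicit.
Unset Printing Implicit Defensive.

Import GRing.Theory.
Local Open Scope ring_scope.

(** Write A_c for Q(2B)_1^{2,t,c} with t = 2^(n-2), and y for beta gamma. The
    first Frobenius twist of A_c is A_{c^2}. A Morita equivalence between basic
    algebras is induced by an isomorphism which permutes the primitive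
    idempotents, and here it fixes both, since e1 A e1 is commutative while
    e0 A e0 is not. Let x be the product of the leading coefficients of the
    images of beta and gamma. In the 8-dimensional corner e0 A e0 the relations
    force the leading coefficients x^2 of alpha and x^5 of eta, the vanishing of
    every correction term that could affect the parameter, and finally
    x = x^(5(t-1)) and c^2 = c x^2. Hence c = 0, or c = x^2 and rescaling the
    arrows by powers of x identifies A_c with A_1. Conversely A_0 and A_1 are
    isomorphic to their own twists. *)

(** * Morita equivalences between basic algebras *)

(** The algebra is a quotient by a generated ideal, so the relations by themselves only yield
    spanning sets; independence has to be imported from representations. Two facts suffice: the
    eight monomials spanning e0 A e0 are independent, and eta^(t-1) is not a multiple of eta^t. Each
    has its own matrix representation. The comparison takes place inside one algebra carrying two
    systems of generators with the same vertex idempotents; the relations used, except gamma beta =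
    eta^(t-1), are read in e0 A e0. The exponents 2 and 5 are forced by homogeneity. If y has weight
    1, then alpha^2 = y alpha y + ... gives alpha the weight 2, and beta eta = alpha y alpha beta
    gives eta the weight 5. The relation gamma beta = eta^(t-1) then yields x = x^(5(t-1)), while
    the term with coefficient c exceeds the weight of alpha^2 by 2, whence the factor x^2. The two
    equations so obtained are exactly the conditions under which the rescaling by these weights
    respects the relations. *)

Definition restrict_scalars (R S : nzRingType) (g : {rmorphism R -> S})
  (M : lmodType S) : Type := M.

Section RestrictScalars.
Variables (R S : nzRingType) (g : {rmorphism R -> S}).

Section Object.
Variable M : lmodType S.
Local Notation rM := (restrict_scalars g M).

HB.instance Definition _ := GRing.Zmodule.on rM.

Definition restrict_scale (a : R) (x : rM) : rM := g a *: (x : M).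

Lemma restrict_scaleA a b x :
  restrict_scale a (restrict_scale b x) = restrict_scale (a * b) x.
Proof. by rewrite /restrict_scale scalerA rmorphM. Qed.
Lemma restrict_scale1 : left_id 1 restrict_scale.
Proof. by move=> x; rewrite /restrict_scale rmorph1 scale1r. Qed.
Lemma restrict_scaleDr : right_distributive restrict_scale +%R.
Proof. by move=> a x y; rewrite /restrict_scale scalerDr. Qed.
Lemma restrict_scaleDl x : {morph restrict_scale^~ x : a b / a + b}.
Proof. by move=> a b; rewrite /restrict_scale rmorphD scalerDl. Qed.

HB.instance Definition _ := GRing.Zmodule_isLmodule.Build R rM
  restrict_scaleA restrict_scale1 restrict_scaleDr restrict_scaleDl.

End Object.

Definition restrict_map (M N : lmodType S) (f : {linear M -> N}) :
  restrict_scalars g M -> restrict_scalars g N := f.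
Arguments restrict_map {M N} f _.

Lemma restrict_map_is_linear (M N : lmodType S) (f : {linear M -> N}) :
  linear (restrict_map f).
Proof. by move=> a x y; rewrite /restrict_map [LHS]linearP. Qed.

HB.instance Definition _ (M N : lmodType S) (f : {linear M -> N}) :=
  GRing.isLinear.Build R (restrict_scalars g M) (restrict_scalars g N) _
    (restrict_map f) (restrict_map_is_linear f).

End RestrictScalars.

Arguments restrict_map {R S} g {M N} f.

Section IsoMorita.
Variable k : fieldType.

Lemma restrict_map_alg (A B : algType k) (g : {lrmorphism B -> A})
    (M N : lmodType A) (a : k) (f f' h : {linear M -> N}) :
  (forall x, h x = (a%:A : A) *: f x + f' x) ->
  forall y, restrict_map g h y =
    (a%:A : B) *: restrict_map g f y + restrict_map g f' y.
Proof.
have ga : g a%:A = a%:A by rewrite linearZ_LR rmorph1.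
by move=> e y; rewrite -[RHS]/(g a%:A *: f y + f' y) ga; exact: e.
Qed.

(** Restriction leaves the underlying maps unchanged, so the functor laws hold definitionally and
    the counit of a pair of such functors is the identity map. *)
Definition restriction_functor (A B : algType k) (g : {lrmorphism B -> A}) :
    linear_functor A B :=
  @LinearFunctor k A B (fun M => restrict_scalars g M)
    (fun M N f => restrict_map g f)
    (fun M f fE => fE) (fun L M N f f' h hE => hE) (restrict_map_alg (g := g)).

Lemma restriction_quasi_inverse (A B : algType k) (f : {lrmorphism A -> B})
    (g : {lrmorphism B -> A}) : cancel f g ->
  left_quasi_inverse (restriction_functor g) (restriction_functor f).
Proof.
move=> fK.
pose eps0 (M : lmodType A) : restrict_scalars f (restrict_scalars g M) -> M :=
  fun x => x.
have eps_lin M : linear (eps0 M).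
  by move=> a x y; rewrite -[LHS]/(g (f a) *: (x : M) + (y : M)) fK.
pose epsL M := GRing.isLinear.Build A (restrict_scalars f (restrict_scalars g M)) M _ _ (eps_lin M).
pose eps M : {linear _ -> _} := HB.pack (eps0 M) (epsL M).
exists eps; split=> [M|M N h x].
  by exists id.
by [].
Qed.

Lemma alg_iso_bij_inv (A B : algType k) (f : {lrmorphism A -> B}) :
  bijective f -> exists g : {lrmorphism B -> A}, cancel f g /\ cancel g f.
Proof.
case=> g fK gK.
have g_lin : linear g by move=> a x y; apply: (can_inj fK); rewrite gK [RHS]linearP /= !gK.
have g_mul : monoid_morphism g.
  split=> [|x y]; apply: (can_inj fK); first by rewrite gK [RHS]rmorph1.
  by rewrite gK [RHS]rmorphM /= !gK.
pose gL := GRing.isLinear.Build k B A _ g g_lin.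
pose gM := GRing.isMonoidMorphism.Build B A g g_mul.
pose h : {lrmorphism B -> A} := HB.pack g gL gM.
by exists h; split; [exact: fK|exact: gK].
Qed.

Lemma algebra_isomorphic_sym (A B : algType k) :
  algebra_isomorphic A B -> algebra_isomorphic B A.
Proof.
by case=> f /alg_iso_bij_inv[g [fK gK]]; exists g, f.
Qed.

Lemma algebra_isomorphic_trans (A B C : algType k) :
  algebra_isomorphic A B -> algebra_isomorphic B C -> algebra_isomorphic A C.
Proof.
case=> f bf [g bg].
exists (g \o f : {lrmorphism A -> C}); exact: bij_comp.
Qed.

Lemma algebra_isomorphic_morita (A B : algType k) :
  algebra_isomorphic A B -> morita_equivalent A B.
Proof.
case=> f /alg_iso_bij_inv[g [fK gK]].
by exists (restriction_functor g), (restriction_functor f); split;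
  apply: restriction_quasi_inverse.
Qed.

End IsoMorita.

Section FunctorFacts.
Variables (k : fieldType) (A B : algType k).

(** The composition law is stated up to pointwise equality; with the identity as one factor it
    becomes extensionality. *)
Lemma fmap_ext (F : linear_functor A B) (M N : lmodType A)
  (f g : {linear M -> N}) : f =1 g -> fmap F f =1 fmap F g.
Proof.
move=> fg x; have := @fmap_comp _ _ _ F M M N idfun g f fg x.
by rewrite /= (@fmap_id _ _ _ F M idfun).
Qed.

Lemma fmapD (F : linear_functor A B) (M N : lmodType A)
  (f g h : {linear M -> N}) : (forall x, h x = f x + g x) ->
  forall y, fmap F h y = fmap F f y + fmap F g y.
Proof.
move=> e y; rewrite (@fmap_linear _ _ _ F M N 1 f g h).
  by rewrite !scale1r.
by move=> x; rewrite e !scale1r.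
Qed.

End FunctorFacts.

(** Naturality of the counit recovers [f] from its image, as the conjugate of [fmap G (fmap F f)] by
    the bijections [eps]. *)
Lemma fmap_faithful (k : fieldType) (A B : algType k)
    (F : linear_functor A B) (G : linear_functor B A)
    (FG : left_quasi_inverse F G) (M N : lmodType A) (f g : {linear M -> N}) :
  fmap F f =1 fmap F g -> f =1 g.
Proof.
case: FG => eps [ebij enat] fg x.
have [h _ hK] := ebij M.
by rewrite -(hK x) -!enat (fmap_ext fg).
Qed.

Lemma linear_inverse (R : nzRingType) (M N : lmodType R)
  (f : {linear M -> N}) : bijective f ->
  exists g : {linear N -> M}, cancel f g /\ cancel g f.
Proof.
case=> g fK gK.
have g_lin : linear g.
  by move=> a x y; apply: (can_inj fK); rewrite gK [RHS]linearP /= !gK.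
pose gL := GRing.isLinear.Build R N M _ g g_lin.
pose h : {linear N -> M} := HB.pack g gL.
by exists h; split; [exact: fK | exact: gK].
Qed.

Section EquivalenceFacts.
Variables (k : fieldType) (A B : algType k).
Variables (F : linear_functor A B) (G : linear_functor B A).
Hypotheses (FG : left_quasi_inverse F G) (GF : left_quasi_inverse G F).

(** The candidate is [fmap G h] conjugated by the counit. Its image under F agrees with [h] after
    applying G, and G is faithful. *)
Lemma fmap_full (M N : lmodType A) (h : {linear F M -> F N}) :
  exists f : {linear M -> N}, fmap F f =1 h.
Proof.
case: (FG) => eps [ebij enat].
have [g [epsK gK]] := linear_inverse (ebij M).
pose f : {linear M -> N} := eps N \o (fmap G h \o g).
exists f; apply: (fmap_faithful GF) => x.
have [g' e'K _] := ebij N; apply: (can_inj e'K).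
by rewrite enat /f /= epsK.
Qed.

(* As A generates the A-modules, FA generates the B-modules. *)
Lemma fmap_generator (S : lmodType B) (p : {linear B^o -> S}) b :
  p b != 0 -> exists (f : {linear F A^o -> B^o}) m, p (f m) != 0.
Proof.
move=> pb; apply: boolp.contrapT => np.
have pf0 (f : {linear F A^o -> B^o}) m : p (f m) = 0.
  by apply: boolp.contrapT => /eqP pm; apply: np; exists f, m.
case: (GF) => del [dbij dnat].
have Gp0 y : fmap G p y = 0.
  (* Every [y] in G B is reached from A: [u] sends 1 to [y], so [v] below sends 1 to
     [fmap G p y]. *)
  pose u0 : A^o -> G B^o := fun a => a *: y.
  have u_lin : linear u0.
    by move=> a x z; rewrite /u0 scalerDl -scalerA.
  pose uL := GRing.isLinear.Build A A^o (G B^o) _ u0 u_lin.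
  pose u : {linear A^o -> G B^o} := HB.pack u0 uL.
  have [d' dK _] := dbij S.
  pose v : {linear A^o -> G S} := fmap G p \o u.
  (* Conjugated by the counit [del], the map F v is [p] composed with a map from F A to B, and such
     composites vanish by assumption. *)
  have Fv0 : fmap F v =1 fmap F (\0 : {linear A^o -> G S}).
    have z0 x : fmap F (\0 : {linear A^o -> G S}) x = 0.
      apply: (@addrI _ (fmap F (\0 : {linear A^o -> G S}) x)); rewrite addr0.
      by rewrite -(@fmapD _ _ _ F _ _ \0 \0 \0) // => z /=; rewrite addr0.
    move=> x; rewrite z0; apply: (can_inj dK); rewrite linear0.
    rewrite (@fmap_comp _ _ _ F _ _ _ u (fmap G p) v) //= dnat.
    exact: (pf0 (del B^o \o fmap F u)).
  by have := fmap_faithful FG Fv0 1; rewrite /v /= /u0 scale1r.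
have : p =1 (\0 : {linear B^o -> S}).
  apply: (fmap_faithful GF) => x; rewrite Gp0.
  apply/esym/(@addrI _ (fmap G (\0 : {linear B^o -> S}) x)); rewrite addr0.
  by rewrite -(@fmapD _ _ _ G _ _ \0 \0 \0) // => z /=; rewrite addr0.
by move/(_ b)/eqP; rewrite (negPf pb).
Qed.

End EquivalenceFacts.

(* [e] is a family of orthogonal idempotents of sum 1 with pairwise
   non-isomorphic local corners of residue field [k], recorded by [rho]. *)
Definition basic_idempotents (k : fieldType) (I : finType) (A : algType k)
    (e : I -> A) (rho : I -> {rmorphism A -> k}) : Prop :=
  [/\ forall i j, e i * e j = if i == j then e i else 0,
      \sum_i e i = 1,
      forall i j, rho i (e j) = (i == j)%:R &
      forall i x, rho i x != 0 -> exists y, y * (e i * x * e i) = e i].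

Section BasicMorita.
Variables (k : fieldType) (I : finType) (A B : algType k).
Variables (e : I -> A) (rho : I -> {rmorphism A -> k}).
Variables (f : I -> B) (tau : I -> {rmorphism B -> k}).
Hypotheses (eP : basic_idempotents e rho) (fP : basic_idempotents f tau).
Variables (F : linear_functor A B) (G : linear_functor B A).
Hypotheses (FG : left_quasi_inverse F G) (GF : left_quasi_inverse G F).

(** Right multiplications are the endomorphisms of the left regular module; their images under F
    make F A a B-A-bimodule. *)
Definition rmul (a : A) (x : A^o) : A^o := (x : A) * a.
Lemma rmul_is_linear a : linear (rmul a).
Proof. by move=> b x y; rewrite /rmul mulrDl -[RHS]/(b * (x * a) + y * a) mulrA. Qed.
HB.instance Definition _ a :=
  GRing.isLinear.Build A A^o A^o _ (rmul a) (rmul_is_linear a).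

Local Notation FA := (fobj F A^o).

Definition ract (a : A) : FA -> FA := fmap F (rmul a).
HB.instance Definition _ a := GRing.Linear.on (ract a).

Lemma ract1 x : ract 1 x = x.
Proof. by apply: (@fmap_id _ _ _ F _ (rmul 1)) => y; rewrite /= /rmul mulr1. Qed.

Lemma ractM a b x : ract (a * b) x = ract b (ract a x).
Proof. by apply: (@fmap_comp _ _ _ F _ _ _ (rmul a) (rmul b)) => y; rewrite /= /rmul mulrA. Qed.

Lemma ractD a b x : ract (a + b) x = ract a x + ract b x.
Proof. by apply: fmapD => y; rewrite /= /rmul mulrDr. Qed.

Lemma ractZ (l : k) a x : ract (l *: a) x = (l%:A : B) *: ract a x.
Proof.
have r0 y : ract 0 y = 0.
  by apply: (@addrI _ (ract 0 y)); rewrite -ractD !addr0.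
rewrite -[RHS]addr0 -(r0 x); apply: (@fmap_linear _ _ _ F) => y.
rewrite /= /rmul mulr0 addr0 -scalerAr.
by rewrite -[RHS]/(l%:A * (y * a)) -scalerAl mul1r.
Qed.

Lemma ract0 x : ract 0 x = 0.
Proof. by apply: (@addrI _ (ract 0 x)); rewrite -ractD !addr0. Qed.

Lemma ract_sum (J : Type) (r : seq J) (h : J -> A) x :
  ract (\sum_(i <- r) h i) x = \sum_(i <- r) ract (h i) x.
Proof.
by elim: r => [|i r IH]; rewrite ?big_nil ?big_cons ?ract0 // ractD IH.
Qed.

Lemma ract_inj a b : ract a =1 ract b -> a = b.
Proof. by move/(fmap_faithful FG)/(_ 1); rewrite /= /rmul !mul1r. Qed.

Lemma ract_full (h : {linear FA -> FA}) : exists a, h =1 ract a.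
Proof.
have [u uE] := fmap_full FG GF h.
exists (u 1) => x; rewrite -uE; apply: fmap_ext => y /=.
by rewrite /rmul -[LHS](congr1 u (mulr1 y)) [LHS]linearZ.
Qed.

(** The map [psi] and b |-> b m are mutually inverse between (F A) e_i and B f_j: the indecomposable
    projective B f_j comes from some A e_i. *)
Lemma projective_cover_vertex (j : I) :
  exists (i : I) (psi : {linear FA -> B^o}) (m : FA),
    [/\ psi m = f j, f j *: m = m, ract (e i) m = m,
        forall x, psi x * f j = psi x &
        forall x, (psi (ract (e i) x) : B) *: m = ract (e i) x].
Proof.
case: eP fP => [ee e1 re el] [ff f1 tf fl].
(* The simple B-module at [j]. Since F A is a generator, some map from F A to B stays nonzero modulo
   the kernel of [tau j]. *)
pose S := restrict_scalars (tau j) k^o.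
pose p0 : B^o -> S := fun b => tau j b.
have p_lin : linear p0.
  by move=> a x y; rewrite /p0 rmorphD; congr (_ + _); exact: rmorphM.
pose pL := GRing.isLinear.Build B B^o S _ p0 p_lin.
pose p : {linear B^o -> S} := HB.pack p0 pL.
have p1 : p 1 != 0 by rewrite /p /= /p0 rmorph1 oner_neq0.
have [phi [m0 pm0]] := fmap_generator FG GF p1.
have [i pi0] : exists i, tau j (phi (ract (e i) m0)) != 0.
  apply: boolp.contrapT => np; move/eqP: pm0; apply.
  rewrite -(ract1 m0) -e1 ract_sum linear_sum /= /p0 rmorph_sum big1 // => i _.
  by apply: boolp.contrapT => /eqP ne; apply: np; exists i.
have [y yP] := fl _ _ pi0; set b := phi _ in pi0 yP.
have fjj : f j * f j = f j by rewrite ff eqxx.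
have eii : e i * e i = e i by rewrite ee eqxx.
pose psi0 (x : FA) : B^o := (phi x : B) * f j.
have psi_lin : linear psi0.
  move=> a x z; rewrite /psi0 linearP mulrDl; congr (_ + _).
  exact: esym (mulrA _ _ _).
pose psiL := GRing.isLinear.Build B FA B^o _ psi0 psi_lin.
have [psi psiE] : exists psi : {linear FA -> B^o}, psi =1 psi0.
  by pose psi : {linear FA -> B^o} := HB.pack psi0 psiL; exists psi.
pose m : FA := (f j * y * f j) *: ract (e i) m0.
have psim : psi m = f j.
  rewrite psiE /psi0 /m linearZ /= -/b -[RHS]fjj -[X in _ = _ * X]yP.
  by rewrite -[_ *: _]/(f j * y * f j * b) !mulrA.
have fm : f j *: m = m by rewrite /m scalerA !mulrA fjj.
have em : ract (e i) m = m by rewrite /m linearZ /= -ractM eii.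
have psif x : psi x * f j = psi x by rewrite psiE /psi0 -mulrA fjj.
exists i, psi, m; split=> //.
(* This endomorphism of F A is the right action of some [a], an idempotent of the local corner e_i A
   e_i. Hence [a] is 0 or e_i, and 0 would give f_j = psi m = 0. *)
pose h0 (x : FA) : FA := (psi (ract (e i) x) : B) *: m.
have h_lin : linear h0.
  move=> a x z; rewrite /h0 !linearP scalerDl; congr (_ + _).
  exact: esym (scalerA _ _ _).
pose hL := GRing.isLinear.Build B FA FA _ h0 h_lin.
pose h : {linear FA -> FA} := HB.pack h0 hL.
have [a ha] := ract_full h.
have hE x : ract a x = (psi (ract (e i) x) : B) *: m by rewrite -ha.
have aa : a * a = a.
  apply: ract_inj => x; rewrite ractM !hE linearZ /= em linearZ psim.
  by rewrite -scalerA fm.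
have ea : e i * a = a by apply: ract_inj => x; rewrite ractM !hE -ractM eii.
have ae : a * e i = a.
  by apply: ract_inj => x; rewrite ractM !hE linearZ /= em.
suff aE : a = e i by move=> x; rewrite -hE aE.
have [ra0|ra] := eqVneq (rho i a) 0; last first.
  have [z] := el _ _ ra; rewrite ea ae => za.
  by rewrite -ea -[in LHS]za -mulrA aa.
have rea : rho i (e i - a) != 0.
  by rewrite rmorphB re eqxx ra0 subr0 oner_neq0.
have [z] := el _ _ rea.
rewrite mulrBr mulrBl eii ea ae eii => zE.
have a0 : a = 0 by rewrite -ea -zE -mulrA mulrBl ea aa subrr mulr0.
have m00 : m = 0 by rewrite -fm -psim -{1}em -hE a0 ract0.
have := tf j j; rewrite -psim m00 linear0 rmorph0 eqxx => /esym/eqP.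
by rewrite oner_eq0.
Qed.

(** The isomorphisms between (F A) e_(s j) and B f_j add up to an isomorphism from F A to B, under
    which [M] corresponds to 1. Comparing endomorphism rings gives [Theta], characterised by M a =
    Theta(a) M. *)
Lemma morita_basic_equiv :
  exists (Theta : {lrmorphism A -> B}) (s : I -> I),
    [/\ bijective Theta, bijective s & forall j, Theta (e (s j)) = f j].
Proof.
have [s /fin_all_exists[psi /fin_all_exists[m psiP]]] :=
  fin_all_exists projective_cover_vertex.
case: eP fP => [ee e1 re el] [ff f1 tf fl].
(* If s j = s l with j and l distinct, then f_j factors through f_l, which [tau j] sends to 0. *)
have s_inj : injective s.
  move=> j l sjl; apply/eqP; apply: contraT => jl.
  have [psj _ emj _ _] := psiP j; have [_ _ _ psifl pslE] := psiP l.
  have mE : m j = (psi l (m j) : B) *: m l.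
    by rewrite -[in LHS]emj sjl -pslE -sjl emj.
  have := tf j j; rewrite -[in LHS]psj mE linearZ /= -psifl.
  rewrite -[_ *: _]/(psi l (m j) * f l * psi j (m l)) !rmorphM tf (negPf jl).
  by rewrite mulr0 mul0r eqxx => /esym/eqP; rewrite oner_eq0.
pose M := \sum_l m l.
pose Psi0 (x : FA) : B^o := \sum_j psi j (ract (e (s j)) x).
have Psi_lin : linear Psi0.
  move=> a x y; rewrite /Psi0 scaler_sumr -big_split /=.
  by apply: eq_bigr => j _; rewrite !linearP.
pose PsiL := GRing.isLinear.Build B FA B^o _ Psi0 Psi_lin.
have [Psi PsiE] : exists Psi : {linear FA -> B^o}, Psi =1 Psi0.
  by pose Psi : {linear FA -> B^o} := HB.pack Psi0 PsiL; exists Psi.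
have em j l : ract (e (s j)) (m l) = if j == l then m l else 0.
  have [_ _ eml _ _] := psiP l.
  rewrite -{1}eml -ractM ee (inj_eq s_inj) eq_sym.
  by case: eqP; rewrite ?ract0.
have eM j : ract (e (s j)) M = m j.
  rewrite linear_sum (bigD1 j) //= em eqxx big1 ?addr0 // => l.
  by rewrite eq_sym em => /negPf ->.
have PsiM : Psi M = 1.
  rewrite PsiE -f1; apply: eq_bigr => j _; rewrite eM.
  by have [] := psiP j.
have PsiK x : (Psi x : B) *: M = x.
  rewrite PsiE [LHS]scaler_suml -[RHS]ract1 -e1 ract_sum [RHS](reindex_inj s_inj) /=.
  apply: eq_bigr => j _; have [_ _ _ psif psE] := psiP j.
  rewrite /M scaler_sumr (bigD1 j) //= psE big1 ?addr0 // => l lj.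
  have [_ fml _ _ _] := psiP l.
  by rewrite -psif -fml scalerA -mulrA ff eq_sym (negPf lj) mulr0 scale0r.
pose Th a : B := Psi (ract a M).
have Th_lin : linear Th.
  move=> l a b; rewrite /Th ractD ractZ linearD linearZ /=.
  by congr (_ + _); exact: mulr_algl.
have Th_mul : monoid_morphism Th.
  split=> [|a b]; first by rewrite /Th ract1.
  rewrite /Th ractM -[ract a M]PsiK !linearZ /= PsiM.
  by rewrite -[_ *: 1]/(_ * 1) mulr1.
pose ThL := GRing.isLinear.Build k A B _ Th Th_lin.
pose ThM := GRing.isMonoidMorphism.Build A B Th Th_mul.
pose Theta : {lrmorphism A -> B} := HB.pack Th ThL ThM.
exists Theta, s; split; last 2 first.
- exact: injF_bij.
- by move=> j; rewrite /= /Th eM PsiE /Psi0 (bigD1 j) //= em eqxx big1 ?addr0;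
    have [] := psiP j => // + _ _ _ _ l lj; rewrite em (negPf lj) linear0.
(* Right multiplication by [b] on B, transported to F A, is the right action of a preimage of
   [b]. *)
have Th_surj b : exists a, Th a = b.
  pose h0 (x : FA) : FA := ((Psi x : B) * b) *: M.
  have h_lin : linear h0.
    by move=> a x z; rewrite /h0 linearP mulrDl scalerDl scalerA mulrA.
  pose hL := GRing.isLinear.Build B FA FA _ h0 h_lin.
  pose h : {linear FA -> FA} := HB.pack h0 hL.
  have [a ha] := ract_full h; exists a.
  rewrite /Th -ha /= /h0 linearZ /= PsiM mul1r.
  exact: mulr1.
have Th_inj : injective Th.
  move=> a b ab; apply: ract_inj => x; rewrite -[x]PsiK !linearZ /=.
  by rewrite -[ract a M]PsiK -[ract b M]PsiK; congr (_ *: (_ *: _)).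
have [g gK] := boolp.choice Th_surj.
by exists g => // x; apply: Th_inj; rewrite gK.
Qed.

End BasicMorita.

(** * Presentations by quivers with relations *)

Section PathAlgebraLift.
Variables (k : comNzRingType) (Q : quiver) (B : algType k).
Local Notation kQ := (path_algebra k Q).
Variables (vtx : vertex Q -> B) (arr : arrow Q -> B).
Hypothesis vtxM : forall v w, vtx v * vtx w = if v == w then vtx v else 0.
Hypothesis vtx_sum : \sum_v vtx v = 1.
Hypothesis arr_source : forall a, vtx (source a) * arr a = arr a.
Hypothesis arr_target : forall a, arr a * vtx (target a) = arr a.

Definition path_eval (x : qpath Q) : B :=
  vtx (path_source x) * \prod_(a <- (val x).2) arr a.

(** The idempotent of the end vertex is absorbed; this makes the values of two paths that do not
    compose multiply to 0. *)
Lemma walk_eval v p : is_walk v p ->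
  vtx v * (\prod_(a <- p) arr a) * vtx (last v (map (@target Q) p)) =
  vtx v * \prod_(a <- p) arr a.
Proof.
elim: p v => [|a p IHp] v /=.
  by rewrite big_nil mulr1 vtxM eqxx.
case/andP=> /eqP <- wp; rewrite big_cons -(arr_target a) -!mulrA.
by rewrite (mulrA (vtx (target a))) (IHp _ wp).
Qed.

Lemma path_evalM x y :
  path_eval x * path_eval y =
  if path_cat x y is Some z then path_eval z else 0.
Proof.
have xE : path_eval x * vtx (path_target x) = path_eval x.
  exact: walk_eval (valP x).
have [exy|nxy] := eqVneq (path_target x) (path_source y).
  have [z [-> sz _ pz]] := path_catE exy.
  rewrite /path_eval sz pz big_cat /= -exy !mulrA.
  by rewrite -/(path_eval x) xE.
rewrite path_catN; last exact/eqP.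
by rewrite -xE -mulrA [vtx _ * _]mulrA vtxM (negPf nxy) mul0r mulr0.
Qed.

Lemma path_algebra_lift :
  exists phi : {lrmorphism kQ -> B},
    (forall v, phi (path_elt k (trivial_path v)) = vtx v) /\
    (forall a, phi (path_elt k (arrow_path a)) = arr a).
Proof.
have [phi0 phi0E] : exists phi0 : {linear kQ -> B},
    forall x, phi0 (path_elt k x) = path_eval x.
  by exists (linear_extension path_eval) => x; exact: lextU.
have trivE v : path_eval (trivial_path v) = vtx v.
  by rewrite /path_eval /= big_nil mulr1.
have phi_mul : monoid_morphism phi0.
  split=> [|f g].
    rewrite [1](_ : _ = pa_one k Q) // linear_sum -vtx_sum.
    by apply: eq_bigr => v _; rewrite phi0E trivE.
  have basis x : phi0 \o pa_mul (path_elt k x) =1 path_eval x \*o phi0.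
    apply: lin_ext_eq => y; rewrite /= phi0E path_evalM pa_mulU /path_mul.
    by case: path_cat => [z|]; rewrite ?phi0E ?linear0.
  apply: (lin_ext_eq (F := phi0 \o pa_mulr g) (G := phi0 g \o* phi0)) => x.
  by rewrite /= phi0E; exact: basis.
pose phiM := GRing.isMonoidMorphism.Build kQ B phi0 phi_mul.
pose phiL := GRing.isLinear.Build k kQ B _ phi0 (linearP phi0).
pose phi : {lrmorphism kQ -> B} := HB.pack (phi0 : kQ -> B) phiL phiM.
exists phi; split=> [v|a]; rewrite /= phi0E ?trivE //.
by rewrite /path_eval /= big_seq1 arr_source.
Qed.

End PathAlgebraLift.

Section PathAlgebraGeneration.
Variables (k : comNzRingType) (Q : quiver).
Local Notation kQ := (path_algebra k Q).

Lemma path_elt_arrowM a (x : qpath Q) : target a = path_source x ->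
  exists y, [/\ path_source y = source a, (val y).2 = a :: (val x).2 &
    path_elt k y = path_elt k (arrow_path a) * path_elt k x].
Proof.
move=> tx; have [z [zE sz _ pz]] := @path_catE Q (arrow_path a) x tx.
by exists z; split=> //; rewrite [RHS]pa_mulU /path_mul zE.
Qed.

Lemma path_algebra_ind (P : kQ -> Prop) :
  P 0 -> (forall a x y, P x -> P y -> P (a *: x + y)) ->
  (forall v, P (path_elt k (trivial_path v))) ->
  (forall a x, P x -> P (path_elt k (arrow_path a) * x)) ->
  forall x, P x.
Proof.
move=> P0 PD Pv Pa; have Pp (x : qpath Q) : P (path_elt k x).
  have [p xp] : exists p, (val x).2 = p by exists (val x).2.
  elim: p x xp => [|a p IHp] x xp.
    by rewrite (_ : x = trivial_path (path_source x)) //; exact: qpath_eq.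
  have := valP x; rewrite xp /= => /andP[/eqP sa wp].
  pose x' := @QPath Q (target a, p) wp.
  have [//|y [sy py yE]] := @path_elt_arrowM a x'.
  rewrite (_ : x = y) ?yE; first exact/Pa/IHp.
  by apply: qpath_eq; rewrite ?sy ?py.
move=> x; rewrite [x]pa_decomp; elim: (enum_fset _) => [|y r IHr].
  by rewrite big_nil.
by rewrite big_cons; apply: PD.
Qed.

End PathAlgebraGeneration.

Section QuotientMap.
Variables (k : comNzRingType) (A : algType k) (J : proper_twosided_ideal A).
Local Notation AJ := (quotient_algebra J).

Definition quot_proj (x : A) : AJ := (\pi_AJ x)%qT.

Lemma quot_proj_is_linear : linear quot_proj.
Proof. by move=> a x y; rewrite /quot_proj -quot_addE -quot_scaleE. Qed.
Lemma quot_proj_is_monoid_morphism : monoid_morphism quot_proj.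
Proof. by split=> // x y; rewrite /quot_proj -quot_mulE. Qed.

HB.instance Definition _ :=
  GRing.isLinear.Build k A AJ _ quot_proj quot_proj_is_linear.
HB.instance Definition _ :=
  GRing.isMonoidMorphism.Build A AJ quot_proj quot_proj_is_monoid_morphism.

Lemma quot_projP x y : quot_proj x = quot_proj y <-> J (x - y).
Proof. exact: quot_eqP. Qed.

Lemma quot_proj_surj u : exists x, u = quot_proj x.
Proof. by exists (repr u); rewrite /quot_proj reprK. Qed.

Lemma quotient_lift (B : algType k) (phi : {lrmorphism A -> B}) :
  (forall x, J x -> phi x = 0) ->
  exists psi : {lrmorphism AJ -> B}, forall x, psi (quot_proj x) = phi x.
Proof.
move=> J0; pose psi0 (u : AJ) : B := phi (repr u).
have psiE x : psi0 (quot_proj x) = phi x.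
  by apply/eqP; rewrite -subr_eq0 -rmorphB; apply/eqP/J0/repr_pi.
have psi_lin : linear psi0.
  move=> a u v; have [x ->] := quot_proj_surj u; have [y ->] := quot_proj_surj v.
  by rewrite -linearP !psiE linearP.
have psi_mul : monoid_morphism psi0.
  split=> [|u v]; first by rewrite -(rmorph1 quot_proj) psiE rmorph1.
  have [x ->] := quot_proj_surj u; have [y ->] := quot_proj_surj v.
  by rewrite -rmorphM !psiE rmorphM.
pose psiL := GRing.isLinear.Build k AJ B _ psi0 psi_lin.
pose psiM := GRing.isMonoidMorphism.Build AJ B psi0 psi_mul.
by pose psi : {lrmorphism AJ -> B} := HB.pack psi0 psiL psiM; exists psi.
Qed.

End QuotientMap.

(* The elements satisfying the relations with s = 2, that is, an algebra morphism
   from Q(2B)_1^{2,t,c} to B. *)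
Record rep2B (k : fieldType) (t : nat) (c : k) (B : algType k) := Rep2B {
  e0 : B; e1 : B; al : B; be : B; ga : B; et : B;
  e00 : e0 * e0 = e0; e11 : e1 * e1 = e1;
  e01 : e0 * e1 = 0; e10 : e1 * e0 = 0; e0De1 : e0 + e1 = 1;
  e0al : e0 * al = al; ale0 : al * e0 = al;
  e0be : e0 * be = be; bee1 : be * e1 = be;
  e1ga : e1 * ga = ga; gae0 : ga * e0 = ga;
  e1et : e1 * et = et; ete1 : et * e1 = et;
  gabe : ga * be = et ^+ (t - 1);
  beet : be * et = al * be * ga * al * be;
  etga : et * ga = ga * al * be * ga * al;
  alal : al * al = be * ga * al * be * ga + c *: (be * ga * al) ^+ 2;
  alalbe : al * al * be = 0
}.

(** * Consequences of the relations and the multiplication table of e0 A e0 *)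

Section Rep2BTheory.
Variables (k : fieldType) (t : nat) (c : k) (B : algType k).
Variable X : rep2B t c B.
Hypothesis ht : (3 <= t)%N.

Local Notation e0 := (e0 X).
Local Notation e1 := (e1 X).
Local Notation al := (al X).
Local Notation be := (be X).
Local Notation ga := (ga X).
Local Notation et := (et X).
Local Notation y := (be * ga).

(** Using the relation for [be * et] twice produces the factor al al be, which is zero. *)
Lemma beet2 : be * et * et = 0.
Proof.
rewrite beet -(mulrA _ be et) beet !mulrA.
rewrite -(mulrA _ al al) -(mulrA _ (al * al) be) alalbe.
by rewrite mulr0 !mul0r.
Qed.

Lemma etetga : et * (et * ga) = 0.
Proof.
rewrite etga !mulrA etga -(mulrA _ al al) -(mulrA _ (al * al) be) alalbe.
by rewrite mulr0 !mul0r.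
Qed.

Lemma be_etX n : be * et ^+ n.+2 = 0.
Proof. by rewrite !exprS !mulrA beet2 mul0r. Qed.

Lemma etX_ga n : et ^+ n.+2 * ga = 0.
Proof. by rewrite !exprSr -!mulrA etetga mulr0. Qed.

(** Here the bound on t enters: the power of [et] equal to [ga * be] is at least the second, so it
    is annihilated by [be] on the left and by [ga] on the right. *)
Lemma t_sub1 : (t - 1 = (t - 3).+2)%N.
Proof. by rewrite -{1}(subnK ht) addn3 subn1. Qed.

Lemma ybe : y * be = 0.
Proof.
by rewrite -mulrA gabe t_sub1 be_etX.
Qed.

Lemma gay : ga * y = 0.
Proof.
by rewrite mulrA gabe t_sub1 etX_ga.
Qed.

Lemma yy : y * y = 0. Proof. by rewrite mulrA ybe mul0r. Qed.

Lemma alaly : al * (al * y) = 0.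
Proof. by rewrite !mulrA alalbe mul0r. Qed.

Lemma alalyM b : al * (al * (y * b)) = 0.
Proof. by rewrite !mulrA alalbe !mul0r. Qed.

(** Both sides are [be * et * ga], expanded by the relation for [be * et] or by the one for
    [et * ga]. *)
Lemma alyaly : al * (y * (al * y)) = y * (al * (y * al)).
Proof.
have := congr1 ( *%R^~ ga) (beet X); rewrite -mulrA etga.
by rewrite !mulrA => <-.
Qed.

Lemma alal_y : al * al = y * (al * y) + c *: (y * (al * (y * al))).
Proof. by rewrite alal expr2 !mulrA. Qed.

(* The general element of the corner e0 A e0; locked, since unfolding it makes
   unification very slow. *)
Definition E a0 a1 a2 a3 a4 a5 a6 a7 : B :=
  locked (a0 *: e0 + a1 *: al + a2 *: y + a3 *: (al * y) + a4 *: (y * al) +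
    a5 *: (al * (y * al)) + a6 *: (y * (al * y)) +
    a7 *: (y * (al * (y * al)))).

Lemma EE a0 a1 a2 a3 a4 a5 a6 a7 : E a0 a1 a2 a3 a4 a5 a6 a7 =
  a0 *: e0 + a1 *: al + a2 *: y + a3 *: (al * y) + a4 *: (y * al) +
  a5 *: (al * (y * al)) + a6 *: (y * (al * y)) + a7 *: (y * (al * (y * al))).
Proof. by rewrite /E -lock. Qed.

Lemma ED a0 a1 a2 a3 a4 a5 a6 a7 b0 b1 b2 b3 b4 b5 b6 b7 :
  E a0 a1 a2 a3 a4 a5 a6 a7 + E b0 b1 b2 b3 b4 b5 b6 b7 =
  E (a0 + b0) (a1 + b1) (a2 + b2) (a3 + b3) (a4 + b4) (a5 + b5) (a6 + b6)
    (a7 + b7).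
Proof.
rewrite !EE !scalerDl.
by do 7!(rewrite [LHS]addrACA; congr (_ + _)).
Qed.

Lemma EZ l a0 a1 a2 a3 a4 a5 a6 a7 :
  l *: E a0 a1 a2 a3 a4 a5 a6 a7 =
  E (l * a0) (l * a1) (l * a2) (l * a3) (l * a4) (l * a5) (l * a6) (l * a7).
Proof. by rewrite !EE !scalerDr !scalerA. Qed.

Lemma e0E a0 a1 a2 a3 a4 a5 a6 a7 :
  e0 * E a0 a1 a2 a3 a4 a5 a6 a7 = E a0 a1 a2 a3 a4 a5 a6 a7.
Proof.
rewrite !EE !mulrDr -!scalerAr e00 e0al.
by rewrite !(mulrA e0) e0al !e0be.
Qed.

Lemma Ee0 a0 a1 a2 a3 a4 a5 a6 a7 :
  E a0 a1 a2 a3 a4 a5 a6 a7 * e0 = E a0 a1 a2 a3 a4 a5 a6 a7.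
Proof.
by rewrite !EE !mulrDl -!scalerAl e00 -!mulrA gae0 ale0.
Qed.

Lemma alE a0 a1 a2 a3 a4 a5 a6 a7 :
  al * E a0 a1 a2 a3 a4 a5 a6 a7 = E 0 a0 0 a2 0 a4 a1 (c * a1 + a6).
Proof.
have al5 : al * (al * (y * al)) = 0 by exact: alalyM.
have al7 : al * (y * (al * (y * al))) = 0.
  by rewrite -alyaly; exact: alalyM.
rewrite {1}EE !mulrDr -!scalerAr ale0 alaly al5 al7 alyaly alal_y.
rewrite !scaler0 !addr0 scalerDr scalerA EE !scale0r !add0r addr0.
rewrite scalerDl (mulrC a1) addr0.
by rewrite [LHS](AC (1*2*1*1*1) (1*4*5*2*(3*6))).
Qed.

Lemma yE a0 a1 a2 a3 a4 a5 a6 a7 :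
  y * E a0 a1 a2 a3 a4 a5 a6 a7 = E 0 0 a0 0 a1 0 a3 a5.
Proof.
have yy0 b : y * (y * b) = 0 by rewrite mulrA yy mul0r.
rewrite {1}EE !mulrDr -!scalerAr !yy0 yy !scaler0 !addr0.
by rewrite -(mulrA be ga e0) gae0 EE !scale0r !add0r !addr0.
Qed.

(** The multiplication table of the corner. The parameter c occurs only in the last coefficient,
    through al al. *)
Lemma EM a0 a1 a2 a3 a4 a5 a6 a7 b0 b1 b2 b3 b4 b5 b6 b7 :
  E a0 a1 a2 a3 a4 a5 a6 a7 * E b0 b1 b2 b3 b4 b5 b6 b7 =
  E (a0 * b0) (a0 * b1 + a1 * b0) (a0 * b2 + a2 * b0)
    (a0 * b3 + a3 * b0 + a1 * b2) (a0 * b4 + a4 * b0 + a2 * b1)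
    (a0 * b5 + a5 * b0 + a1 * b4 + a3 * b1)
    (a0 * b6 + a6 * b0 + a1 * b1 + a2 * b3 + a4 * b2)
    (a0 * b7 + a7 * b0 + c * a1 * b1 + a1 * b6 + a6 * b1 + a2 * b5 + a5 * b2
     + a3 * b3 + a4 * b4).
Proof.
rewrite {1}EE !mulrDl -!scalerAl e0E -!(mulrA al, mulrA y).
rewrite !(alE, yE) !EZ.
by rewrite !ED; congr E; ring.
Qed.

Lemma alyalbe : al * (y * (al * be)) = be * et.
Proof. by rewrite (beet X) !mulrA. Qed.

Lemma Ebe a0 a1 a2 a3 a4 a5 a6 a7 : E a0 a1 a2 a3 a4 a5 a6 a7 * be =
  a0 *: be + a1 *: (al * be) + a4 *: (y * (al * be)) + a5 *: (be * et).
Proof.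
have z0 : y * (be * et) = 0 by rewrite mulrA ybe mul0r.
rewrite {1}EE !mulrDl -!scalerAl -!(mulrA al, mulrA y).
rewrite ybe alyalbe z0 !mulr0 !scaler0 e0be.
by rewrite !addr0.
Qed.

Lemma etX_t : et ^+ t = et * ga * be.
Proof. by rewrite -mulrA gabe -exprS subn1 prednK // (leq_trans _ ht). Qed.

Lemma et_gaalbe : et * (ga * (al * be)) = 0.
Proof. by rewrite mulrA (etga X) !mulrA -(mulrA _ al al) -(mulrA _ (al * al)) alalbe mulr0. Qed.

Lemma gaalbe_et : ga * (al * be) * et = 0.
Proof.
rewrite -!mulrA (beet X) !mulrA -(mulrA ga al al) -(mulrA ga (al * al)) alalbe.
by rewrite mulr0 !mul0r.
Qed.

(** Besides the powers of [et], vertex 1 carries the loop ga al be; its square falls back into those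
    powers. *)
Lemma gaalbe2 : ga * (al * be) * (ga * (al * be)) = et ^+ t.
Proof. by rewrite etX_t (etga X) !mulrA. Qed.

Lemma etX_tS : et ^+ t.+1 = 0.
Proof.
rewrite exprSr etX_t (etga X) -!mulrA (beet X) !mulrA.
by rewrite -(mulrA _ al al) -(mulrA _ (al * al)) alalbe mulr0 !mul0r.
Qed.

End Rep2BTheory.

(* Stated for abstract algebras, because rewriting inside the path algebra makes
   unification unfold its product. *)
Section RelatorImage.
Variables (k : fieldType) (R S : algType k) (f : {lrmorphism R -> S}).

Lemma relator_image1 a b g m : f (g * b - a ^+ m) = f g * f b - f a ^+ m.
Proof. by rewrite rmorphB rmorphM rmorphXn. Qed.

(** This shape serves the relation for [be * et] and, after a cyclic shift of the three arrows, also
    the one for [et * ga]. *)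
Lemma relator_image2 a b g u v :
  f (u * v - (a * b * g) ^+ (2 - 1) * a * b) =
  f u * f v - f a * f b * f g * f a * f b.
Proof. by rewrite expr1 rmorphB !rmorphM. Qed.

Lemma relator_image3 a b g c :
  f (a ^+ 2 - ((b * g * a) ^+ (2 - 1) * b * g + c *: (b * g * a) ^+ 2)) =
  f a * f a - (f b * f g * f a * f b * f g + c *: (f b * f g * f a) ^+ 2).
Proof.
rewrite expr1 rmorphB rmorphD /= linearZ /= !rmorphXn /= !rmorphM /=.
by rewrite (expr2 (f a)).
Qed.

Lemma relator_image4 a b : f (a ^+ 2 * b) = f a * f a * f b.
Proof. by rewrite rmorphM rmorphXn expr2. Qed.

End RelatorImage.

Section Presentation.
Variables (k : fieldType) (t : nat) (ht : (3 <= t)%N) (c : k).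
Local Notation A := (Q2B k 2 t (leqnn 2) ht c).
Local Notation kQ := (path_algebra k quiver2B).
Local Notation pr := (quot_proj (ideal2B (leqnn 2) ht c)).
Local Notation vtx v := (path_elt k (trivial_path (Q := quiver2B) v)).

Lemma vtxM v w : vtx v * vtx w = if v == w then vtx v else 0.
Proof.
rewrite [LHS]pa_mulU /path_mul path_cat1 /path_source /=.
by case: eqP => // ->.
Qed.

Lemma vtx_arrowM v a : vtx v * path_elt k (arrow_path a) =
  if v == source a then path_elt k (arrow_path a) else 0.
Proof. by rewrite [LHS]pa_mulU /path_mul path_cat1; case: ifP. Qed.

Lemma arrow_vtxM v a : path_elt k (arrow_path a) * vtx v =
  if v == target a then path_elt k (arrow_path a) else 0.
Proof. by rewrite [LHS]pa_mulU /path_mul path_cat_1; case: ifP. Qed.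

Lemma quot_proj_relator u v : relator2B 2 t c (u - v) -> pr u = pr v.
Proof. by move=> r; apply/quot_projP; constructor. Qed.

Lemma quot_projM u v : pr u * pr v = pr (u * v).
Proof. by rewrite [RHS]rmorphM. Qed.

Lemma quot_projX u n : pr u ^+ n = pr (u ^+ n).
Proof. by rewrite [RHS]rmorphXn. Qed.

(* Transparent, so that its components convert to the classes of the paths. *)
Definition Q2B_rep : rep2B t c A.
Proof.
apply: (@Rep2B k t c A (pr (vtx vertex0)) (pr (vtx vertex1)) (pr (alpha2B k))
  (pr (beta2B k)) (pr (gamma2B k)) (pr (eta2B k)));
  try by rewrite quot_projM ?(vtxM, vtx_arrowM, arrow_vtxM).
- rewrite -[LHS](rmorphD pr) -[RHS](rmorph1 pr); congr (pr _).
  rewrite [RHS]/(pa_one k quiver2B) /pa_one big_ord_recl big_ord1.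
  by congr (_ + vtx _); apply: val_inj.
- by rewrite quot_projM quot_projX; exact/quot_proj_relator/rel_gamma_beta.
- rewrite !quot_projM; apply: quot_proj_relator.
  by have := rel_beta_eta 2 t c; rewrite expr1.
- rewrite !quot_projM; apply: quot_proj_relator.
  by have := rel_eta_gamma 2 t c; rewrite expr1.
- rewrite !quot_projM quot_projX -[c *: _](linearZ_LR pr) -[RHS](rmorphD pr).
  apply: quot_proj_relator.
  by have := rel_alpha2 2 t c; rewrite expr1 (expr2 (alpha2B k)).
- rewrite !quot_projM -(rmorph0 pr); apply: quot_proj_relator; rewrite subr0.
  by have := rel_alpha2_beta 2 t c; rewrite expr2.
Defined.

Lemma Q2B_ind (P : A -> Prop) :
  P 0 -> (forall a x y, P x -> P y -> P (a *: x + y)) ->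
  P (e0 Q2B_rep) -> P (e1 Q2B_rep) ->
  (forall x, P x -> P (al Q2B_rep * x)) ->
  (forall x, P x -> P (be Q2B_rep * x)) ->
  (forall x, P x -> P (ga Q2B_rep * x)) ->
  (forall x, P x -> P (et Q2B_rep * x)) -> forall x, P x.
Proof.
move=> P0 PD Pe0 Pe1 Pal Pbe Pga Pet u.
have [x ->] := quot_proj_surj u.
apply: (@path_algebra_ind _ _ (fun x => P (pr x))) x => [|a x y|v|a x].
- by rewrite rmorph0.
- by rewrite linearP; apply: PD.
- have [->|->] : v = vertex0 \/ v = vertex1.
    by case: v => [[|[|m]] lm] //; [left | right]; apply: val_inj.
  + exact: Pe0.
  + exact: Pe1.
- rewrite rmorphM; case: a => Px;
    [exact: Pal | exact: Pbe | exact: Pga | exact: Pet].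
Qed.

Lemma Q2B_lift (B : algType k) (X : rep2B t c B) :
  exists phi : {lrmorphism A -> B},
    (phi (e0 Q2B_rep) = e0 X /\ phi (e1 Q2B_rep) = e1 X) /\
    [/\ phi (al Q2B_rep) = al X, phi (be Q2B_rep) = be X,
        phi (ga Q2B_rep) = ga X & phi (et Q2B_rep) = et X].
Proof.
pose v (i : vertex quiver2B) := if i == vertex0 then e0 X else e1 X.
pose w (a : arrow quiver2B) :=
  match a with Alpha => al X | Beta => be X | Gamma => ga X | Eta => et X end.
have [|||| phi [phiv phia]] := @path_algebra_lift k quiver2B B v w.
- move=> i j; rewrite /v.
  have [/negPf vv _] : vertex1 != vertex0 /\ True by [].
  have v01 (l : 'I_2) : l = vertex0 \/ l = vertex1.
    by case: l => [[|[|m]] lm] //; [left | right]; apply: val_inj.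
  by case: (v01 i) (v01 j) => -> [] ->; rewrite ?eqxx ?vv ?(eq_sym vertex0) ?vv ?e00 ?e01 ?e10 ?e11.
- rewrite big_ord_recl big_ord1 /v /=; exact: e0De1.
- by case; rewrite /v /= ?e0al ?e0be ?e1ga ?e1et.
- by case; rewrite /v /= ?ale0 ?bee1 ?gae0 ?ete1.
have [|psi psiE] := @quotient_lift _ _ (ideal2B (leqnn 2) ht c) B phi.
  move=> x; elim=> {x} [x||x y _ IHx _ IHy|a x _ IH|a x _ IH].
  - have pa : phi (alpha2B k) = al X by exact: (phia Alpha).
    have pb : phi (beta2B k) = be X by exact: (phia Beta).
    have pg : phi (gamma2B k) = ga X by exact: (phia Gamma).
    have pe : phi (eta2B k) = et X by exact: (phia Eta).
    case.
    + by apply: etrans (relator_image1 phi _ _ _ _) _; rewrite pb pg pe gabe subrr.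
    + apply: etrans (relator_image2 phi _ _ _ _ _) _.
      by rewrite pa pb pg pe beet subrr.
    + apply: etrans (relator_image2 phi _ _ _ _ _) _.
      by rewrite pa pb pg pe etga subrr.
    + by apply: etrans (relator_image3 phi _ _ _ _) _; rewrite pa pb pg alal subrr.
    + by apply: etrans (relator_image4 phi _ _) _; rewrite pa pb alalbe.
  - exact: rmorph0.
  - by rewrite rmorphD /= IHx IHy addr0.
  - by rewrite rmorphM /= IH mulr0.
  - by rewrite rmorphM /= IH mul0r.
exists psi; rewrite /= !psiE !phiv.
by split; [rewrite /v | split; exact: phia].
Qed.

(** Two lifts are recognised as mutually inverse by checking their composites on the generators
    only. *)
Lemma Q2B_endo_id (phi : {lrmorphism A -> A}) :
  phi (e0 Q2B_rep) = e0 Q2B_rep -> phi (e1 Q2B_rep) = e1 Q2B_rep ->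
  phi (al Q2B_rep) = al Q2B_rep -> phi (be Q2B_rep) = be Q2B_rep ->
  phi (ga Q2B_rep) = ga Q2B_rep -> phi (et Q2B_rep) = et Q2B_rep ->
  phi =1 id.
Proof.
move=> h0 h1 ha hb hg he; apply: Q2B_ind => //; first exact: rmorph0.
- by move=> a x y hx hy; rewrite [LHS]linearP /= hx hy.
- by move=> x hx; rewrite rmorphM /= ha hx.
- by move=> x hx; rewrite rmorphM /= hb hx.
- by move=> x hx; rewrite rmorphM /= hg hx.
- by move=> x hx; rewrite rmorphM /= he hx.
Qed.

End Presentation.

Global Opaque Q2B_rep.

(** * Two matrix representations *)

Section SparseMatrix.
Variables (k : fieldType) (N : nat).
Implicit Types s : seq (k * nat * nat).

(** Triples are coefficient, row, column. Natural numbers as indices let products of concrete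
    matrices reduce by computation. *)
Definition sparse_mx s : 'M[k]_N.+1 :=
  \sum_(x <- s) x.1.1 *: delta_mx (inord x.1.2) (inord x.2).

Definition sparse_mul s s' : seq (k * nat * nat) :=
  flatten [seq [seq (x.1.1 * y.1.1, x.1.2, y.2) | y <- s' & x.2 == y.1.2]
          | x <- s].

Definition in_range s := all (fun x => (x.1.2 <= N) && (x.2 <= N))%N s.

Lemma sparse_mxM s s' : in_range s -> in_range s' ->
  sparse_mx s * sparse_mx s' = sparse_mx (sparse_mul s s').
Proof.
move=> rs rs'; rewrite /sparse_mx big_flatten big_map mulr_suml.
rewrite !big_seq; apply: eq_bigr => x xs; rewrite mulr_sumr big_map big_filter.
rewrite [RHS]big_mkcond !big_seq; apply: eq_bigr => y ys.
have /andP[_ x2] := allP rs _ xs; have /andP[y1 _] := allP rs' _ ys.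
rewrite -scalerAl -scalerAr scalerA [delta_mx _ _ * _]mul_delta_mx_cond.
rewrite -(inj_eq val_inj) /= !inordK //.
by case: eqP => // _; rewrite mulr0n scaler0.
Qed.

Lemma sparse_mxD s s' : sparse_mx s + sparse_mx s' = sparse_mx (s ++ s').
Proof. by rewrite /sparse_mx big_cat. Qed.

Lemma sparse_mxZ a s :
  a *: sparse_mx s = sparse_mx [seq (a * x.1.1, x.1.2, x.2) | x <- s].
Proof.
by rewrite /sparse_mx scaler_sumr big_map; apply: eq_bigr => x _; rewrite scalerA.
Qed.

Lemma sparse_mxE s i j : in_range s -> (i <= N)%N -> (j <= N)%N ->
  sparse_mx s (inord i) (inord j) =
  \sum_(a <- [seq x.1.1 | x <- s & (x.1.2 == i) && (x.2 == j)]) a.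
Proof.
move=> rs iN jN; rewrite /sparse_mx summxE big_map big_filter.
rewrite [RHS]big_mkcond !big_seq.
apply: eq_bigr => x xs; have /andP[x1 x2] := allP rs _ xs.
rewrite !mxE -!(inj_eq val_inj) /= !inordK // (eq_sym i) (eq_sym j).
by case: andP; rewrite ?mulr1 ?mulr0.
Qed.

End SparseMatrix.

Section ProjectiveRep.
Variables (k : fieldType) (t : nat) (ht : (3 <= t)%N) (c : k).

Local Notation S := (@sparse_mx k 11).
Let e0L := [seq (1 : k, i, i) | i <- iota 0 8].
Let e1L := [seq (1 : k, i, i) | i <- iota 8 4].
Local Notation "i ~> j" := (1 : k, i%N, j%N) (at level 50).
Let alL := [:: 0 ~> 1; 1 ~> 6; (c, 1%N, 7%N); 2 ~> 4; 3 ~> 5; 6 ~> 7].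
Let beL := [:: 0 ~> 8; 1 ~> 9; 4 ~> 10; 5 ~> 11].
Let gaL := [:: 8 ~> 2; 9 ~> 3; 10 ~> 6; 11 ~> 7].
Let etL := [:: 8 ~> 11].

(* The right module e0 A on the basis 1, al, y, al y, y al, al y al, y al y,
   y al y al, be, al be, y al be, al y al be, where y = be ga. *)
Lemma projective_rep : exists X : rep2B t c 'M[k]_12,
  forall a0 a1 a2 a3 a4 a5 a6 a7,
    [seq E X a0 a1 a2 a3 a4 a5 a6 a7 (inord 0) (inord j) | j <- iota 0 8] =
    [:: a0; a1; a2; a3; a4; a5; a6; a7].
Proof.
have sM := sparse_mxM.
have sD := sparse_mxD.
(* The matrix of [etL] has square zero, and t - 1 is at least 2. *)
have St0 : S etL ^+ (t - 1) = 0.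
  by rewrite -(subnK ht) addn3 subn1 /= !exprS mulrA sM //= /sparse_mx big_nil mul0r.
have S0 : 0 = S [::] by rewrite /sparse_mx big_nil.
simple refine (let X := @Rep2B k t c 'M[k]_12 (S e0L) (S e1L) (S alL)
  (S beL) (S gaL) (S etL) _ _ _ _ _ _ _ _ _ _ _ _ _ _ _ _ _ _ in _).
all: rewrite ?St0 ?S0.
all: try by rewrite !sM // -?S0; congr S;
  rewrite /e0L /e1L /alL /beL /gaL /etL /sparse_mul /= ?mulr1 ?mul1r.
- rewrite sD /sparse_mx -map_cat -iotaD big_map -[RHS]/(1%:M) mx1_sum_delta.
  rewrite -[iota 0 _]/(index_iota 0 12) big_mkord; apply: eq_bigr => i _.
  by rewrite scale1r inord_val.
- rewrite expr2 !sM // sparse_mxZ sD /sparse_mx /= !big_cons !big_nil /=.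
  by rewrite !mulr1 !mul1r !addr0 addrCA addrC addrA.
exists X => a0 a1 a2 a3 a4 a5 a6 a7.
(* Matrices act on row vectors, and row 0 is the image of the basis vector 1; it therefore lists the
   coefficients of the element. *)
rewrite EE [X in map X]/= /X /= !sM // !sparse_mxZ !sD.
do 8!(congr (_ :: _); first by rewrite sparse_mxE //= big_seq1 !mulr1).
Qed.

End ProjectiveRep.

(* al acts as zero, and et as the shift v_0 -> v_1 -> ... -> v_(t-1); ga and be
   send v_0 to v_t and v_t to v_(t-1). *)
Section ShiftRep.
Variables (k : fieldType) (t : nat) (ht : (3 <= t)%N) (c : k).

Local Notation M := 'M[k]_t.+1.

(** The bound [j < t] leaves out the last basis vector, which belongs to vertex 0; thus [shift_mx 0]
    is the idempotent at vertex 1 and not the identity. *)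
Definition shift_mx n : M := \matrix_(i, j) ((i + n == j) && (j < t))%N%:R.

Lemma shift_mx_delta n (a b : 'I_t.+1) : shift_mx n * delta_mx a b =
  \matrix_(i, j) [&& i + n == a, a < t & j == b]%N%:R.
Proof.
apply/matrixP=> i j; rewrite !mxE (bigD1 a) //= big1 => [|l /negPf la].
  by rewrite !mxE eqxx addr0 -natrM mulnb -andbA.
by rewrite !mxE la mulr0.
Qed.

Lemma delta_shift_mx n (a b : 'I_t.+1) : delta_mx a b * shift_mx n =
  \matrix_(i, j) [&& i == a, b + n == j & j < t]%N%:R.
Proof.
apply/matrixP=> i j; rewrite !mxE (bigD1 b) //= big1 => [|l /negPf lb].
  by rewrite !mxE eqxx andbT addr0 -natrM mulnb.
by rewrite !mxE lb andbF mul0r.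
Qed.

Lemma shift_mxM m n : shift_mx m * shift_mx n = shift_mx (m + n).
Proof.
apply/matrixP=> i j; rewrite !mxE.
have [lt_t|le_t] := ltnP (i + m) t.
  have lt_t1 : (i + m < t.+1)%N by exact: ltnW.
  rewrite (bigD1 (Ordinal lt_t1)) //= big1 => [|l].
    by rewrite !mxE /= eqxx lt_t mul1r addr0 addnA.
  rewrite -val_eqE /= eq_sym => /negPf nl; by rewrite mxE nl mul0r.
rewrite big1 => [|l _].
  case: eqP => //= ij; case: ltnP => // jt; suff: (t <= j)%N by rewrite leqNgt jt.
  by rewrite -ij addnA; apply: leq_trans le_t (leq_addr _ _).
rewrite mxE; case: eqP => [<-|_]; last by rewrite mul0r.
by rewrite ltnNge le_t mul0r.
Qed.

Lemma shift_mxX n : shift_mx 1 ^+ n.+1 = shift_mx n.+1.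
Proof. by elim: n => [|n IH] //; rewrite exprS IH shift_mxM. Qed.

Lemma shift_rep : exists X : rep2B t c M,
  et X ^+ (t - 1) != 0 /\ et X ^+ t = 0.
Proof.
have t0 : (0 < t)%N by apply: leq_trans ht.
have lt_t1 : (t.-1 < t)%N by rewrite prednK.
pose l : 'I_t.+1 := Ordinal (ltnW lt_t1 : t.-1 < t.+1)%N.
pose g : M := delta_mx ord0 ord_max; pose b : M := delta_mx ord_max l.
have s0b : shift_mx 0 * b = 0.
  by apply/matrixP=> i j; rewrite shift_mx_delta !mxE /= ltnn andbF.
have bs0 : b * shift_mx 0 = b.
  apply/matrixP=> i j; rewrite delta_shift_mx !mxE -(val_eqE j) /= addn0.
  by rewrite (eq_sym (val j)) /=; case: (t.-1 =P j) => [<-|]; rewrite ?lt_t1 ?andbF ?andbT.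
have s0g : shift_mx 0 * g = g.
  apply/matrixP=> i j; rewrite shift_mx_delta !mxE -(val_eqE i) /= addn0.
  by rewrite t0.
have gs0 : g * shift_mx 0 = 0.
  apply/matrixP=> i j; rewrite delta_shift_mx !mxE /= addn0.
  by case: (t =P j) => [<-|]; rewrite ?ltnn ?andbF.
have s1g : shift_mx 1 * g = 0.
  by apply/matrixP=> i j; rewrite shift_mx_delta !mxE /= addn1.
have bs1 : b * shift_mx 1 = 0.
  apply/matrixP=> i j; rewrite delta_shift_mx !mxE /= addn1 prednK //.
  by case: (t =P j) => [<-|]; rewrite ?ltnn ?andbF.
(* A shift by t - 1 that stays below t moves only v_0, to v_(t-1), so it is a single matrix unit. *)
have gb : g * b = shift_mx 1 ^+ (t - 1).
  rewrite (t_sub1 ht) shift_mxX -(t_sub1 ht) /g /b -[LHS]/(_ *m _) mul_delta_mx.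
  apply/matrixP=> i j; rewrite !mxE -!val_eqE /= subn1.
  congr (_%:R); congr nat_of_bool; apply/andP/andP => [[/eqP-> /eqP->]|[/eqP ij jt]].
    by rewrite add0n.
  have i0 : (i : nat) = 0%N.
    apply/eqP; rewrite -leqn0 -(leq_add2r t.-1) ij add0n.
    by rewrite -ltnS prednK.
  by rewrite i0 eqxx -ij i0 add0n.
simple refine (let X := @Rep2B k t c M (1 - shift_mx 0) (shift_mx 0) 0 b g
  (shift_mx 1) _ _ _ _ _ _ _ _ _ _ _ _ _ _ _ _ _ _ in _);
  rewrite ?mulr0 ?mul0r ?mulr0 ?mulrBl ?mulrBr ?mul1r ?mulr1 ?shift_mxM ?s0b ?bs0 ?s0g
    ?gs0 ?s1g ?bs1 ?gb ?subrr ?subr0 ?subrK ?expr2 ?mulr0 ?scaler0 ?mul0r ?addr0 //.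
have sX n : (0 < n)%N -> shift_mx 1 ^+ n = shift_mx n.
  by case: n => // n _; rewrite shift_mxX.
exists X; rewrite /= !sX ?(t_sub1 ht) // -(t_sub1 ht); split; last first.
  by apply/matrixP=> i j; rewrite !mxE; case: eqP => //= <-; rewrite ltnNge leq_addl.
apply/eqP=> /matrixP/(_ ord0 l)/eqP; rewrite !mxE /= add0n subn1 eqxx lt_t1.
by rewrite oner_eq0.
Qed.

End ShiftRep.

(** * Peirce decomposition *)

Lemma E_map (k : fieldType) (t : nat) (c : k) (B C : algType k)
    (X : rep2B t c B) (Y : rep2B t c C) (phi : {lrmorphism B -> C}) :
  phi (e0 X) = e0 Y -> phi (al X) = al Y -> phi (be X) = be Y ->
  phi (ga X) = ga Y -> forall a0 a1 a2 a3 a4 a5 a6 a7,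
  phi (E X a0 a1 a2 a3 a4 a5 a6 a7) = E Y a0 a1 a2 a3 a4 a5 a6 a7.
Proof.
move=> h0 ha hb hg a0 a1 a2 a3 a4 a5 a6 a7.
by rewrite !EE !linearD !linearZ /= !rmorphM /= ?rmorphM /= ?rmorphM /= h0 ha hb hg.
Qed.

(** The geometric series of [n] works: since n e = n, the factor e - n equals -(n - 1) e. *)
Lemma nilpotent_local (R : nzRingType) (e n : R) m :
  n * e = n -> n ^+ m = 0 -> exists y, y * (e - n) = e.
Proof.
move=> ne n0; exists (\sum_(i < m) n ^+ i); set s := \sum_(i < m) _.
have cs : GRing.comm s (n - 1).
  apply/commr_sym/commr_sum => i _; apply/commr_sym.
  by apply: commrB; [apply/commr_sym/commrX | exact: commr1].
have -> : e - n = - ((n - 1) * e) by rewrite mulrBl mul1r ne opprB.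
by rewrite mulrN mulrA cs -subrX1 n0 sub0r mulN1r opprK.
Qed.

Section Corners.
Variables (k : fieldType) (t : nat) (ht : (3 <= t)%N) (c : k).
Variables (B : algType k) (X : rep2B t c B).
Local Notation e0 := (e0 X).
Local Notation e1 := (e1 X).
Local Notation al := (al X).
Local Notation be := (be X).
Local Notation ga := (ga X).
Local Notation et := (et X).
Local Notation y := (be * ga).

Definition in_corner x := exists a0 a1 a2 a3 a4 a5 a6 a7,
  x = E X a0 a1 a2 a3 a4 a5 a6 a7.

Lemma in_corner0 : in_corner 0.
Proof.
exists 0, 0, 0, 0, 0, 0, 0, 0; rewrite EE.
by rewrite !scale0r !addr0.
Qed.

Lemma in_corner_e0 : in_corner e0.
Proof.
exists 1, 0, 0, 0, 0, 0, 0, 0; rewrite EE.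
by rewrite !scale0r !addr0 scale1r.
Qed.

Lemma in_cornerD x z : in_corner x -> in_corner z -> in_corner (x + z).
Proof.
move=> [? [? [? [? [? [? [? [? ->]]]]]]]] [? [? [? [? [? [? [? [? ->]]]]]]]].
by rewrite ED; do 8!eexists.
Qed.

Lemma in_cornerZ a x : in_corner x -> in_corner (a *: x).
Proof.
by move=> [? [? [? [? [? [? [? [? ->]]]]]]]]; rewrite EZ; do 8!eexists.
Qed.

Lemma in_corner_al x : in_corner x -> in_corner (al * x).
Proof.
by move=> [? [? [? [? [? [? [? [? ->]]]]]]]]; rewrite alE //; do 8!eexists.
Qed.

Lemma in_corner_y x : in_corner x -> in_corner (y * x).
Proof.
by move=> [? [? [? [? [? [? [? [? ->]]]]]]]]; rewrite yE //; do 8!eexists.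
Qed.

Lemma be_horner f :
  be * horner_alg et f = f`_0 *: be + f`_1 *: (be * et).
Proof.
elim/poly_ind: f => [|f a IH].
  by rewrite rmorph0 mulr0 !coef0 !scale0r addr0.
rewrite rmorphD rmorphM /= horner_algX horner_algC mulrDr mulrA IH mulrDl.
rewrite -!scalerAl beet2 // scaler0 addr0 -scalerAr mulr1.
by rewrite !coefD !coefMX !coefC /= add0r addr0 addrC.
Qed.

Lemma e1_horner f : e1 * horner_alg et f = horner_alg et f * e1.
Proof.
elim/poly_ind: f => [|f a IH]; first by rewrite rmorph0 mulr0 mul0r.
rewrite rmorphD rmorphM /= horner_algX horner_algC mulrDr mulrDl.
by rewrite -scalerAl -scalerAr mul1r mulr1 mulrA IH -!mulrA e1et ete1.
Qed.

Lemma horner_gaalbe f :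
  horner_alg et f * (ga * (al * be)) = f`_0 *: (ga * (al * be)).
Proof.
elim/poly_ind: f => [|f a IH]; first by rewrite rmorph0 mul0r coef0 scale0r.
rewrite rmorphD rmorphM /= horner_algX horner_algC mulrDl -mulrA et_gaalbe //.
by rewrite mulr0 add0r -scalerAl mul1r coefD coefMX coefC /= add0r.
Qed.

Lemma gaalbe_horner f :
  ga * (al * be) * horner_alg et f = f`_0 *: (ga * (al * be)).
Proof.
elim/poly_ind: f => [|f a IH]; first by rewrite rmorph0 mulr0 coef0 scale0r.
rewrite rmorphD rmorphM /= horner_algX horner_algC mulrDr.
rewrite (mulrA _ (horner_alg et f)) IH.
rewrite -scalerAl gaalbe_et // scaler0 add0r -scalerAr mulr1.
by rewrite coefD coefMX coefC /= add0r.
Qed.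

(** The Peirce form of an element: the corner at vertex 0, its multiples by [be] and by [ga], and at
    vertex 1 the polynomials in [et] with the extra loop ga al be. Uniqueness of the coefficients is
    not claimed. *)
Definition in_span x := exists w p q f u,
  [/\ in_corner w, in_corner p, in_corner q &
      x = w + p * be + ga * q + e1 * horner_alg et f + u *: (ga * (al * be))].

Lemma in_span0 : in_span 0.
Proof.
exists 0, 0, 0, 0, 0; split; try exact: in_corner0.
by rewrite rmorph0 !mulr0 mul0r scale0r !addr0.
Qed.

Lemma in_spanD a x z : in_span x -> in_span z -> in_span (a *: x + z).
Proof.
move=> [w [p [q [f [u [cw cp cq ->]]]]]] [w' [p' [q' [f' [u' [cw' cp' cq' ->]]]]]].
exists (a *: w + w'), (a *: p + p'), (a *: q + q'), (a *: f + f'), (a * u + u').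
split; try by apply: in_cornerD => //; apply: in_cornerZ.
rewrite (linearP (horner_alg et)) /= !mulrDr !mulrDl.
rewrite -!scalerAr -!scalerAl !scalerDl !scalerDr scalerA.
rewrite mul1r -!scalerAr.
by do 4!(rewrite [LHS]addrACA; congr (_ + _)).
Qed.

Lemma in_span_corner w : in_corner w -> in_span w.
Proof.
move=> cw; exists w, 0, 0, 0, 0; split=> //; try exact: in_corner0.
by rewrite rmorph0 !mulr0 mul0r scale0r !addr0.
Qed.

Lemma in_span_be p : in_corner p -> in_span (p * be).
Proof.
move=> cp; exists 0, p, 0, 0, 0; split=> //; try exact: in_corner0.
by rewrite rmorph0 !mulr0 scale0r !addr0 add0r.
Qed.

Lemma in_span_ga q : in_corner q -> in_span (ga * q).
Proof.
move=> cq; exists 0, 0, q, 0, 0; split=> //; try exact: in_corner0.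
by rewrite rmorph0 !mulr0 mul0r scale0r !addr0 !add0r.
Qed.

Lemma in_span_e1 f : in_span (e1 * horner_alg et f).
Proof.
exists 0, 0, 0, f, 0; split=> //; try exact: in_corner0.
by rewrite !mulr0 mul0r scale0r !addr0 !add0r.
Qed.

Lemma in_span_gaalbe : in_span (ga * (al * be)).
Proof.
exists 0, 0, 0, 0, 1; split=> //; try exact: in_corner0.
by rewrite rmorph0 !mulr0 mul0r scale1r !addr0 !add0r.
Qed.

Lemma in_spanDr x z : in_span x -> in_span z -> in_span (x + z).
Proof. by move=> sx sz; rewrite -[x]scale1r; apply: in_spanD. Qed.

Lemma in_spanZ a x : in_span x -> in_span (a *: x).
Proof. by move=> sx; rewrite -[_ *: x]addr0; apply: in_spanD; rewrite //; exact: in_span0. Qed.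

Lemma corner_e0 w : in_corner w -> e0 * w = w.
Proof. by move=> [? [? [? [? [? [? [? [? ->]]]]]]]]; rewrite e0E. Qed.

Lemma corner_e0r w : in_corner w -> w * e0 = w.
Proof. by move=> [? [? [? [? [? [? [? [? ->]]]]]]]]; rewrite Ee0. Qed.

Lemma e0_ga : e0 * ga = 0. Proof. by rewrite -(e1ga X) mulrA e01 mul0r. Qed.
Lemma al_ga : al * ga = 0. Proof. by rewrite -(ale0 X) -mulrA e0_ga mulr0. Qed.
Lemma al_e1 : al * e1 = 0. Proof. by rewrite -(ale0 X) -mulrA e01 mulr0. Qed.
Lemma be_e0 : be * e0 = 0. Proof. by rewrite -(bee1 X) -mulrA e10 mulr0. Qed.
Lemma ga_e1 : ga * e1 = 0. Proof. by rewrite -(gae0 X) -mulrA e01 mulr0. Qed.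
Lemma ga_ga : ga * ga = 0. Proof. by rewrite -{1}(gae0 X) -mulrA e0_ga mulr0. Qed.
Lemma et_e0 : et * e0 = 0. Proof. by rewrite -(ete1 X) -mulrA e10 mulr0. Qed.

Lemma span_al x : in_span x -> in_span (al * x).
Proof.
move=> [w [p [q [f [u [cw cp cq ->]]]]]]; rewrite !mulrDr -scalerAr !mulrA.
rewrite al_ga al_e1 !mul0r scaler0 !addr0 -mulrA.
by apply: in_spanDr; [apply/in_span_corner | rewrite mulrA; apply/in_span_be];
  apply: in_corner_al.
Qed.

Lemma span_be x : in_span x -> in_span (be * x).
Proof.
move=> [w [p [q [f [u [cw cp cq ->]]]]]]; rewrite !mulrDr -scalerAr.
rewrite -(corner_e0 cw) -(corner_e0 cp) !mulrA be_e0 !mul0r !add0r.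
rewrite bee1 be_horner; apply: in_spanDr; last first.
  apply/in_spanZ/in_span_be; rewrite -(ale0 X).
  exact/in_corner_y/in_corner_al/in_corner_e0.
apply: in_spanDr; first exact/in_span_corner/in_corner_y.
apply: in_spanDr; apply: in_spanZ.
  by rewrite -(e0be X); apply/in_span_be/in_corner_e0.
have -> : be * et = al * (y * (al * e0)) * be.
  by rewrite -alyalbe -!mulrA e0be.
exact/in_span_be/in_corner_al/in_corner_y/in_corner_al/in_corner_e0.
Qed.

Lemma span_ga x : in_span x -> in_span (ga * x).
Proof.
move=> [w [p [q [f [u [cw cp cq ->]]]]]]; rewrite !mulrDr -scalerAr !mulrA.
rewrite ga_ga ga_e1 !mul0r scaler0 !addr0 -mulrA.
apply: in_spanDr; first exact: in_span_ga.
move: cp => [? [? [? [? [? [? [? [? ->]]]]]]]]; rewrite Ebe // !mulrDr.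
have gay_al : ga * (y * (al * be)) = 0 by rewrite mulrA gay ?mul0r.
have e1X n : in_span (et ^+ n.+1).
  have := in_span_e1 ('X ^+ n.+1); rewrite rmorphXn /= horner_algX exprS mulrA e1et.
  by rewrite -exprS.
rewrite -!scalerAr gay_al scaler0 addr0; apply: in_spanDr.
  apply: in_spanDr; apply: in_spanZ; last exact: in_span_gaalbe.
  by rewrite gabe (t_sub1 ht).
by apply: in_spanZ; rewrite mulrA gabe (t_sub1 ht) -exprSr.
Qed.

Lemma span_et x : in_span x -> in_span (et * x).
Proof.
move=> [w [p [q [f [u [cw cp cq ->]]]]]]; rewrite !mulrDr -scalerAr et_gaalbe //.
rewrite -(corner_e0 cw) -(corner_e0 cp) scaler0 !mulrA et_e0 !mul0r !add0r addr0.
apply: in_spanDr.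
  have -> : et * ga * q = ga * (al * (y * (al * q))) by rewrite (etga X) !mulrA.
  exact/in_span_ga/in_corner_al/in_corner_y/in_corner_al.
rewrite ete1 -{1}(e1et X) -{1}(horner_algX et) -mulrA -rmorphM.
exact: in_span_e1.
Qed.

End Corners.

Section Peirce.
Variables (k : fieldType) (t : nat) (ht : (3 <= t)%N) (c : k).
Variables (B : algType k) (X : rep2B t c B).
Local Notation e0 := (e0 X).
Local Notation e1 := (e1 X).
Local Notation al := (al X).
Local Notation be := (be X).
Local Notation ga := (ga X).
Local Notation et := (et X).
Hypothesis spanX : forall x, in_span X x.

Lemma peirce00 x : in_corner X (e0 * x * e0).
Proof.
have [w [p [q [f [u [cw cp cq ->]]]]]] := spanX x.
rewrite !mulrDr !mulrDl -scalerAr -scalerAl (mulrA e0 e1) e01 !mul0r addr0.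
rewrite (mulrA e0 ga) (mulrA e0 ga) e0_ga !mul0r scaler0 !addr0.
by rewrite corner_e0 // corner_e0r // -!mulrA be_e0 !mulr0 addr0.
Qed.

Lemma peirce01 x : exists2 p, in_corner X p & e0 * x * e1 = p * be.
Proof.
have [w [p [q [f [u [cw cp cq ->]]]]]] := spanX x; exists p => //.
rewrite !mulrDr !mulrDl -scalerAr -scalerAl (mulrA e0 e1) e01 !mul0r addr0.
rewrite (mulrA e0 ga) (mulrA e0 ga) e0_ga !mul0r scaler0 !addr0.
by rewrite corner_e0 // -{1}(corner_e0r cw) -!mulrA e01 bee1 mulr0 add0r mulrA corner_e0.
Qed.

Lemma peirce10 x : exists2 q, in_corner X q & e1 * x * e0 = ga * q.
Proof.
have [w [p [q [f [u [cw cp cq ->]]]]]] := spanX x; exists q => //.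
rewrite !mulrDr !mulrDl -scalerAr -scalerAl -[in LHS](corner_e0 cw).
rewrite -[in LHS](corner_e0 cp) !mulrA e10 !mul0r !add0r e1ga e11.
rewrite -[ga * q * e0]mulrA corner_e0r // e1_horner -(mulrA _ e1) e10.
by rewrite -!mulrA be_e0 !mulr0 scaler0 !addr0.
Qed.

Lemma peirce11 x : exists f u,
  e1 * x * e1 = e1 * horner_alg et f + u *: (ga * (al * be)).
Proof.
have [w [p [q [f [u [cw cp cq ->]]]]]] := spanX x; exists f, u.
rewrite !mulrDr !mulrDl -scalerAr -scalerAl -[in LHS](corner_e0 cw).
rewrite -[in LHS](corner_e0 cp) !mulrA e10 !mul0r !add0r e1ga e11.
rewrite -[in LHS](corner_e0r cq) -!mulrA e01 !mulr0 add0r bee1.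
by rewrite -e1_horner mulrA e11.
Qed.

End Peirce.

Lemma corner_nilpotent (k : fieldType) (t : nat) (ht : (3 <= t)%N) (c : k)
    (B : algType k) (X : rep2B t c B) a1 a2 a3 a4 a5 a6 a7 :
  E X 0 a1 a2 a3 a4 a5 a6 a7 ^+ 8 = 0.
Proof.
rewrite (_ : 8 = 2 * (2 * 2))%N // !exprM !expr2 !EM //.
by rewrite !(mul0r, mulr0, addr0, add0r) EE !scale0r !addr0.
Qed.

Section LoopCorner.
Variables (k : fieldType) (t : nat) (ht : (3 <= t)%N) (c : k).
Variables (B : algType k) (X : rep2B t c B).
Local Notation e1 := (e1 X).
Local Notation et := (et X).
Local Notation g' := (ga X * (al X * be X)).

Lemma peirce11_e1 f u :
  (e1 * horner_alg et f + u *: g') * e1 = e1 * horner_alg et f + u *: g'.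
Proof. by rewrite mulrDl -scalerAl -!mulrA bee1 -e1_horner (mulrA e1) e11. Qed.

(** The cross terms vanish and the square of ga al be is et^t, so the square of the element is
    [et * r] with [r] commuting with [et]; and et^(t+1) = 0. *)
Lemma peirce11_nilpotent h u :
  (e1 * horner_alg et (h * 'X) + u *: g') ^+ (2 * t.+1) = 0.
Proof.
have e1g : e1 * g' = g' by rewrite mulrA e1ga.
have hg : horner_alg et (h * 'X) * g' = 0.
  by rewrite horner_gaalbe // coefMX scale0r.
have gh : g' * horner_alg et (h * 'X) = 0.
  by rewrite gaalbe_horner // coefMX scale0r.
rewrite exprM expr2 mulrDl !mulrDr -!scalerAr -!scalerAl.
rewrite -(mulrA e1 (horner_alg _ _) g') hg mulr0 scaler0 addr0.
rewrite (mulrA g' e1) -(mulrA (ga X)) -(mulrA (al X)) bee1 gh scaler0 add0r.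
rewrite gaalbe2 // scalerA (mulrA _ e1) -(mulrA e1) -e1_horner (mulrA e1 e1) e11.
have etH f : et * horner_alg et f = horner_alg et f * et.
  by rewrite -{1 4}(horner_algX et) -!rmorphM mulrC.
pose r := e1 * horner_alg et (h * (h * 'X)) + (u * u) *: et ^+ (t - 1).
have cr : GRing.comm et r.
  rewrite /r /GRing.comm mulrDl mulrDr -scalerAl -scalerAr; congr (_ + _ *: _).
    by rewrite mulrA ete1 -(mulrA e1) -etH (mulrA e1) e1et.
  exact: commrX.
rewrite (_ : _ + _ = et * r); first by rewrite exprMn_comm // etX_tS // mul0r.
rewrite mulrDr -scalerAr -exprS subn1 prednK; last by apply: leq_trans ht.
congr (_ + _); rewrite (mulrA et) ete1 -(mulrA e1) -rmorphM.
rewrite (_ : h * 'X * (h * 'X) = 'X * (h * (h * 'X))); last by ring.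
by rewrite rmorphM /= horner_algX (mulrA e1) e1et.
Qed.

(** Prepares [nilpotent_local]: the term subtracted from e1 has the shape shown nilpotent in
    [peirce11_nilpotent]. *)
Lemma peirce11_split (f g : {poly k}) u : f`_0 != 0 -> f = g * 'X + (f`_0)%:P ->
  e1 * horner_alg et f + u *: g' =
  f`_0 *: (e1 - (e1 * horner_alg et (- (f`_0)^-1 *: g * 'X) + (- (f`_0)^-1 * u) *: g')).
Proof.
set a := f`_0 => a0 ->.
have -> : horner_alg et (- a^-1 *: g * 'X) = - a^-1 *: horner_alg et (g * 'X).
  by rewrite -scalerAl linearZ /= mulr_algl.
rewrite rmorphD /= horner_algC mulrDr -scalerAr mulr1.
rewrite -[e1 * (- a^-1 *: _)]scalerAr scalerBr scalerDr !scalerA mulrA !mulrN mulfV //.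
rewrite (mulrA a) mulrN mulfV // mulN1r !scaleN1r scaleNr.
by rewrite opprD !opprK addrA (addrC (a *: e1)).
Qed.

End LoopCorner.

Lemma scaleX_image (k : fieldType) (B C : algType k) (phi : {lrmorphism B -> C})
    (a b : k) (x : B) m n :
  a *: x ^+ m = b *: x ^+ n -> a *: phi x ^+ m = b *: phi x ^+ n.
Proof. by move/(congr1 phi); rewrite !linearZ /= !rmorphXn. Qed.

Lemma horner_alg_char (k : fieldType) (B C : algType k)
    (phi : {lrmorphism B -> C}) (x : B) f :
  phi x = 0 -> phi (horner_alg x f) = f`_0 *: 1.
Proof.
move=> x0; elim/poly_ind: f => [|f a IH]; first by rewrite !rmorph0 coef0 scale0r.
rewrite rmorphD rmorphM /= horner_algX horner_algC rmorphD rmorphM /= linearZ /=.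
rewrite x0 mulr0 add0r rmorph1.
by rewrite coefD coefMX coefC /= add0r.
Qed.

Lemma peirce11_char (k : fieldType) (t : nat) (c : k) (B C : algType k)
    (X : rep2B t c B) (phi : {lrmorphism B -> C}) f u :
  phi (et X) = 0 -> phi (ga X) = 0 ->
  phi (e1 X * horner_alg (et X) f + u *: (ga X * (al X * be X))) =
  f`_0 *: phi (e1 X).
Proof.
move=> he hg; rewrite rmorphD rmorphM /= linearZ /= rmorphM /= horner_alg_char //.
by rewrite hg mul0r scaler0 addr0 -scalerAr mulr1.
Qed.

(** * Residue characters and local corners at the two vertices *)

Section BasicIdempotents.
Variables (k : fieldType) (t : nat) (ht : (3 <= t)%N) (c : k).
Variables (B : algType k) (X : rep2B t c B).

(** The character of the simple module at a vertex, with [false] for vertex 0 and [true] for vertex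
    1. On its own corner it reads off the constant coefficient; on the other it vanishes. *)
Definition vertex_char (v : bool) (phi : {rmorphism B -> k}) :=
  [/\ phi (e0 X) = (~~ v)%:R, phi (e1 X) = v%:R,
   forall a0 a1 a2 a3 a4 a5 a6 a7,
     phi (E X a0 a1 a2 a3 a4 a5 a6 a7) = a0 *+ ~~ v &
   forall f u, phi (e1 X * horner_alg (et X) f + u *: (ga X * (al X * be X))) =
     f`_0 *+ v].

Definition vertex_idem (v : bool) : B := if v then e1 X else e0 X.

(** A corner element of nonzero residue is a nonzero scalar times the idempotent minus a nilpotent,
    so the geometric series gives a left inverse in the sense required. *)
Lemma rep2B_basic rho : (forall x, in_span X x) ->
  (forall v, vertex_char v (rho v)) -> basic_idempotents vertex_idem rho.
Proof.
move=> spanX rhoP; split.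
- by case=> [] []; rewrite /vertex_idem /= ?e00 ?e01 ?e10 ?e11.
- by rewrite big_bool /vertex_idem /= addrC e0De1.
- by move=> i j; have [h0 h1 _ _] := rhoP i; case: i j h0 h1 => [] [].
move=> i x; have idemK : vertex_idem i * vertex_idem i = vertex_idem i.
  by case: i; rewrite /= ?e00 ?e11.
have [h0 h1 hE hf] := rhoP i.
have rid : rho i (vertex_idem i) = 1.
  by clear hE hf idemK; case: i h0 h1 => /= h0 h1; rewrite /vertex_idem ?h0 ?h1.
have -> : rho i x = rho i (vertex_idem i * x * vertex_idem i).
  by rewrite !rmorphM rid mul1r mulr1.
set xi := vertex_idem i * x * vertex_idem i => x0.
suff [n [m [nK n0 xE]]] : exists n m, [/\ n * vertex_idem i = n, n ^+ m = 0 &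
    xi = rho i xi *: (vertex_idem i - n)].
  have [z zE] := nilpotent_local nK n0.
  move: (rho i xi) x0 xE => l l0 ->; exists (l^-1 *: z).
  by rewrite -scalerAl -scalerAr scalerA mulVf // scale1r.
have xiE : xi = vertex_idem i * x * vertex_idem i by [].
clearbody xi; case: i h0 h1 hE hf idemK rid x0 xiE => _ _ hE hf _ _ x0;
  rewrite /vertex_idem => xiE.
- have [f [u xE]] := peirce11 spanX x.
  move: x0; rewrite xiE xE hf mulr1n => f0.
  have [g fE] : exists g, f = g * 'X + (f`_0)%:P.
    elim/poly_ind: f {xE f0} => [|f a _]; first by exists 0; rewrite mul0r coef0 add0r.
    by exists f; rewrite coefD coefMX coefC /= add0r.
  exists (e1 X * horner_alg (et X) (- (f`_0)^-1 *: g * 'X)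
    + (- (f`_0)^-1 * u) *: (ga X * (al X * be X))), (2 * t.+1)%N.
  split; [exact: peirce11_e1 | exact: peirce11_nilpotent |].
  exact: peirce11_split.
- have [a0 [a1 [a2 [a3 [a4 [a5 [a6 [a7 xE]]]]]]]] := peirce00 spanX x.
  move: x0; rewrite xiE xE hE mulr1n => a00.
  exists (E X 0 (- a0^-1 * a1) (- a0^-1 * a2) (- a0^-1 * a3) (- a0^-1 * a4)
    (- a0^-1 * a5) (- a0^-1 * a6) (- a0^-1 * a7)), 8; split.
  + exact: Ee0.
  + exact: corner_nilpotent.
  have -> : e0 X = E X 1 0 0 0 0 0 0 0 by rewrite EE !scale0r !addr0 scale1r.
  rewrite -scaleN1r EZ ED EZ; congr E; rewrite !(mulr0, addr0, add0r, mulr1) //;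
    by rewrite mulN1r mulNr opprK mulrA mulfV // mul1r.
Qed.

End BasicIdempotents.

Section Q2BStructure.
Variables (k : fieldType) (t : nat) (ht : (3 <= t)%N) (c : k).
Local Notation A := (Q2B k 2 t (leqnn 2) ht c).
Local Notation X := (Q2B_rep ht c).

Lemma Q2B_span x : in_span X x.
Proof.
apply: (Q2B_ind (P := in_span X)) x.
- exact: in_span0.
- by move=> a x z; apply: in_spanD.
- exact/in_span_corner/in_corner_e0.
- by have := in_span_e1 X 1; rewrite rmorph1 mulr1.
- by move=> x; apply: span_al.
- by move=> x; apply: span_be.
- by move=> x; apply: span_ga.
- by move=> x; apply: span_et.
Qed.

(** The coefficients can be read off in the first row of the matrices of [projective_rep]. *)
Lemma E_inj a0 a1 a2 a3 a4 a5 a6 a7 b0 b1 b2 b3 b4 b5 b6 b7 :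
  E X a0 a1 a2 a3 a4 a5 a6 a7 = E X b0 b1 b2 b3 b4 b5 b6 b7 ->
  [:: a0; a1; a2; a3; a4; a5; a6; a7] = [:: b0; b1; b2; b3; b4; b5; b6; b7].
Proof.
have [Y YE] := projective_rep ht c.
have [phi [[h0 _] [ha hb hg _]]] := Q2B_lift ht Y.
have Ephi := E_map h0 ha hb hg; move=> /(congr1 phi) eE.
have {}eE := etrans (esym (Ephi _ _ _ _ _ _ _ _)) (etrans eE (Ephi _ _ _ _ _ _ _ _)).
by rewrite -(YE a0) eE YE.
Qed.

(** In the shift representation et^(t-1) survives while et^t is zero. *)
Lemma etX_sub1_free a b :
  a *: et X ^+ (t - 1) = b *: et X ^+ t -> a = 0.
Proof.
have [Y [Y0 Y1]] := shift_rep ht c.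
have [phi [_ [_ _ _ he]]] := Q2B_lift ht Y.
move/(scaleX_image phi); rewrite he Y1 scaler0 => /eqP.
by rewrite scaler_eq0 (negPf Y0) orbF => /eqP.
Qed.

(** The one-dimensional representation in which one vertex acts as 1 and all arrows as 0; every
    relator consists of products of at least two arrows. *)
Lemma Q2B_vertex_char v : exists phi, vertex_char X v phi.
Proof.
have t0 : (0 : k^o) ^+ (t - 1) = 0 by rewrite (t_sub1 ht) exprS mul0r.
simple refine (let Y := @Rep2B k t c k^o (~~ v)%:R v%:R 0 0 0 0
  _ _ _ _ _ _ _ _ _ _ _ _ _ _ _ _ _ _ in _);
  rewrite ?mulr0 ?mul0r ?t0 ?expr2 ?mulr0 ?scaler0 ?addr0 //;
  try by case: v; rewrite ?mulr1 ?mulr0 ?mul0r ?addr0 ?add0r.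
have [phi [[h0 h1] [ha hb hg he]]] := Q2B_lift ht Y.
exists phi; split=> // [a0 a1 a2 a3 a4 a5 a6 a7|f u].
  apply: etrans (E_map h0 ha hb hg _ _ _ _ _ _ _ _) _; rewrite EE /= !mulr0 !scaler0 !addr0.
  by case: (v); rewrite ?scaler0 // -[LHS]/(a0 * 1) mulr1.
apply: etrans (peirce11_char _ _ he hg) _; rewrite h1 /=.
by case: (v); rewrite ?scaler0 // -[LHS]/(_ * 1) mulr1.
Qed.

Lemma Q2B_basic : exists rho, basic_idempotents (vertex_idem X) rho.
Proof.
have [rho rhoP] := boolp.choice Q2B_vertex_char.
by exists rho; apply: rep2B_basic => //; exact: Q2B_span.
Qed.

End Q2BStructure.

(** * Comparison of two presentations of the same algebra *)

(** On either side, multiplying the loop ga al be by a polynomial in [et] only sees the constant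
    coefficient, so the loop commutes with these polynomials. This later excludes isomorphisms that
    swap the vertices. *)
Lemma peirce11_comm (k : fieldType) (t : nat) (ht : (3 <= t)%N) (c : k)
    (B : algType k) (X : rep2B t c B) x z : (forall x, in_span X x) ->
  e1 X * x * e1 X = x -> e1 X * z * e1 X = z -> x * z = z * x.
Proof.
move=> spanX; have [f [u ->]] := peirce11 spanX x; move=> <-.
have [g [v ->]] := peirce11 spanX z; move=> <-.
set g' := ga X * (al X * be X); set H := horner_alg (et X).
have e1g : e1 X * g' = g' by rewrite mulrA e1ga.
have ge1 : g' * e1 X = g' by rewrite -!mulrA bee1.
have eH p q : e1 X * H p * (e1 X * H q) = e1 X * H (p * q).
  by rewrite mulrA -(mulrA (e1 X)) -e1_horner mulrA e11 -mulrA -rmorphM.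
have Hg p : e1 X * H p * g' = p`_0 *: g'.
  by rewrite -mulrA horner_gaalbe // -scalerAr e1g.
have gH p : g' * (e1 X * H p) = p`_0 *: g'.
  by rewrite mulrA ge1 gaalbe_horner.
rewrite !mulrDl !mulrDr -!scalerAl -!scalerAr !eH !Hg !gH !scalerA.
rewrite (mulrC g) (mulrC v u) -!addrA; congr (_ + _).
by rewrite addrCA.
Qed.

Lemma corner_expr (k : fieldType) (t : nat) (ht : (3 <= t)%N) (c : k)
    (B : algType k) (X : rep2B t c B) n a0 a1 a2 a3 a4 a5 a6 a7 :
  exists b1 b2 b3 b4 b5 b6 b7,
    E X a0 a1 a2 a3 a4 a5 a6 a7 ^+ n.+1 = E X (a0 ^+ n.+1) b1 b2 b3 b4 b5 b6 b7.
Proof.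
elim: n => [|n [b1 [b2 [b3 [b4 [b5 [b6 [b7 IH]]]]]]]]; first by do 7!eexists.
by rewrite exprS IH EM // -exprS; do 7!eexists.
Qed.

Lemma etX_horner (k : fieldType) (t : nat) (ht : (3 <= t)%N) (c : k)
    (B : algType k) (X : rep2B t c B) f :
  et X ^+ (t - 1) * horner_alg (et X) f =
  f`_0 *: et X ^+ (t - 1) + f`_1 *: et X ^+ t.
Proof.
have t1 : ((t - 1).+1 = t)%N by rewrite subn1 prednK // (leq_trans _ ht).
elim/poly_ind: f => [|f a IH].
  by rewrite rmorph0 mulr0 !coef0 !scale0r addr0.
rewrite rmorphD rmorphM /= horner_algX horner_algC mulrDr mulrA IH mulrDl.
rewrite -!scalerAl -!exprSr t1 etX_tS // scaler0 addr0 -scalerAr mulr1.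
by rewrite !coefD !coefMX !coefC /= add0r addr0 addrC.
Qed.

Section TwoPresentations.
Variables (k : fieldType) (t : nat) (ht : (3 <= t)%N) (c c' : k).
Variables (B : algType k) (X : rep2B t c B) (X' : rep2B t c' B).
Hypothesis char2 : 2%N \in [pchar k].
Hypotheses (ee0 : e0 X' = e0 X) (ee1 : e1 X' = e1 X).
Hypotheses (spanX : forall x, in_span X x) (spanX' : forall x, in_span X' x).
Hypothesis EXinj : forall a0 a1 a2 a3 a4 a5 a6 a7 b0 b1 b2 b3 b4 b5 b6 b7,
  E X a0 a1 a2 a3 a4 a5 a6 a7 = E X b0 b1 b2 b3 b4 b5 b6 b7 ->
  [:: a0; a1; a2; a3; a4; a5; a6; a7] = [:: b0; b1; b2; b3; b4; b5; b6; b7].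
Hypothesis etXfree : forall a b,
  a *: et X ^+ (t - 1) = b *: et X ^+ t -> a = 0.

Local Notation "\E[ a0 , a1 , a2 , a3 , a4 , a5 , a6 , a7 ]" :=
  (E X a0 a1 a2 a3 a4 a5 a6 a7).

Let simp0 := (mul0r, mulr0, add0r, addr0, mulr1, mul1r).

Lemma yX : be X * ga X = \E[0, 0, 1, 0, 0, 0, 0, 0].
Proof. by rewrite EE !scale0r !addr0 !add0r scale1r. Qed.

Lemma e0X : e0 X = \E[1, 0, 0, 0, 0, 0, 0, 0].
Proof. by rewrite EE !scale0r !addr0 scale1r. Qed.

Lemma alX : al X = \E[0, 1, 0, 0, 0, 0, 0, 0].
Proof. by rewrite EE !scale0r !addr0 !add0r scale1r. Qed.

Lemma alX' : al X' = E X' 0 1 0 0 0 0 0 0.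
Proof. by rewrite EE !scale0r !addr0 !add0r scale1r. Qed.

Lemma zeroX : 0 = \E[0, 0, 0, 0, 0, 0, 0, 0].
Proof. by rewrite EE !scale0r !addr0. Qed.

Lemma EyX a0 a1 a2 a3 a4 a5 a6 a7 :
  \E[a0, a1, a2, a3, a4, a5, a6, a7] * (be X * ga X) =
  \E[0, 0, a0, a1, 0, 0, a4, a5].
Proof. by rewrite yX EM // !simp0. Qed.

(** The constant coefficient vanishes because [al X'] is nilpotent by the multiplication table of
    its own presentation. *)
Lemma al_leading : exists a u v w a5 a6 a7, al X' = \E[0, a, u, v, w, a5, a6, a7].
Proof.
have := peirce00 spanX (al X'); rewrite -ee0 e0al ale0.
move=> [a0 [a [u [v [w [a5 [a6 [a7 aE]]]]]]]].
have [b1 [b2 [b3 [b4 [b5 [b6 [b7 bE]]]]]]] := corner_expr ht X 7 a0 a u v w a5 a6 a7.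
have := corner_nilpotent ht X' 1 0 0 0 0 0 0; rewrite -alX' aE bE zeroX.
case/EXinj => /eqP; rewrite expf_eq0 => /andP[_ /eqP a00] _ _ _ _ _ _ _.
by exists a, u, v, w, a5, a6, a7; rewrite a00.
Qed.

Lemma be_leading : exists2 p, in_corner X p & be X' = p * be X.
Proof.
by have := peirce01 spanX (be X'); rewrite -ee0 -ee1 e0be bee1.
Qed.

Lemma ga_leading : exists2 q, in_corner X q & ga X' = ga X * q.
Proof.
by have := peirce10 spanX (ga X'); rewrite -ee0 -ee1 e1ga gae0.
Qed.

(** By symmetry [be X] is a corner multiple of [be X']. Multiplying by [ga X] and comparing
    coefficients of y gives r0 p0 = 1. *)
Lemma be_leading_neq0 p0 p1 p2 p3 p4 p5 p6 p7 :
  be X' = \E[p0, p1, p2, p3, p4, p5, p6, p7] * be X -> p0 != 0.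
Proof.
move=> bE; have [r cr] := peirce01 spanX' (be X).
rewrite ee0 ee1 e0be bee1 => rE.
have [r0 [r1 [r2 [r3 [r4 [r5 [r6 [r7 r'E]]]]]]]] := peirce00 spanX r.
have rr : e0 X * r * e0 X = r by rewrite -ee0 corner_e0 // corner_e0r.
move: rE; rewrite -rr r'E bE mulrA EM //.
move/(congr1 ( *%R^~ (ga X))); rewrite -mulrA EyX {1}yX.
case/EXinj => e _ _ _; apply/eqP=> p00; move/eqP: e.
by rewrite p00 mulr0 oner_eq0.
Qed.

Lemma ga_leading_neq0 q0 q1 q2 q3 q4 q5 q6 q7 :
  ga X' = ga X * \E[q0, q1, q2, q3, q4, q5, q6, q7] -> q0 != 0.
Proof.
move=> gE; have [r cr] := peirce10 spanX' (ga X).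
rewrite ee0 ee1 e1ga gae0 => rE.
have [r0 [r1 [r2 [r3 [r4 [r5 [r6 [r7 r'E]]]]]]]] := peirce00 spanX r.
have rr : e0 X * r * e0 X = r by rewrite -ee0 corner_e0 // corner_e0r.
move: rE; rewrite -rr r'E gE -mulrA EM //.
move/(congr1 ( *%R (be X))); rewrite mulrA {1}yX yE //.
case/EXinj => e _ _ _; apply/eqP=> q00; move/eqP: e.
by rewrite q00 mul0r oner_eq0.
Qed.

Lemma y_leading p0 p1 p2 p3 p4 p5 p6 p7 q0 q1 q2 q3 q4 q5 q6 q7 :
  be X' = \E[p0, p1, p2, p3, p4, p5, p6, p7] * be X ->
  ga X' = ga X * \E[q0, q1, q2, q3, q4, q5, q6, q7] ->
  exists y5 y6 y7, be X' * ga X' =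
    \E[0, 0, p0 * q0, p1 * q0, p0 * q1, y5, y6, y7].
Proof.
move=> -> ->; rewrite mulrA -(mulrA _ (be X)) EyX EM // !simp0.
by do 3!eexists.
Qed.

(** Expand [al X] in the second system of generators: among the monomials there, only [al X'] itself
    can have a component along [al X]. *)
Lemma al_leading_neq0 a u v w a5 a6 a7 x m n y5 y6 y7 :
  al X' = \E[0, a, u, v, w, a5, a6, a7] ->
  be X' * ga X' = \E[0, 0, x, m, n, y5, y6, y7] -> a != 0.
Proof.
move=> aE yE; have := peirce00 spanX' (al X); rewrite ee0 e0al ale0.
move=> [b0 [b1 [b2 [b3 [b4 [b5 [b6 [b7]]]]]]]]; rewrite EE aE yE ee0 {1}alX {1}e0X.
rewrite !EM // !EZ !ED !simp0; case/EXinj => _ e _ _ _ _ _ _; apply/eqP=> a00; move/eqP: e.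
by rewrite a00 !simp0 oner_eq0.
Qed.

(** Compare coefficients in alpha^2 = y alpha y + c' (y alpha)^2. Those of al y, al y al and y al y
    give u = 0, v = -w and a = x^2. In that of y al y al the unknown [a6] occurs twice and v^2 + w^2
    = 2 w^2, so characteristic 2 removes both. *)
Lemma alal_leading a u v w a5 a6 a7 x m n y5 y6 y7 :
  al X' = \E[0, a, u, v, w, a5, a6, a7] ->
  be X' * ga X' = \E[0, 0, x, m, n, y5, y6, y7] ->
  [/\ u = 0, a = x ^+ 2 & c * a ^+ 2 = a * x * (m + n) + c' * a ^+ 2 * x ^+ 2].
Proof.
move=> aE yE; have a0 := al_leading_neq0 aE yE.
have := alal_y X'; rewrite aE yE !EM // EZ ED !simp0.
case/EXinj => au e4 e5 e6 e7.
have u0 : u = 0 by apply: (mulfI a0); rewrite au mulr0.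
move: e4 e5 e6 e7; rewrite u0 !simp0 => e4 e5 e6 e7; split=> //.
  by apply: (mulfI a0); rewrite e6; ring.
have vw : v = - w.
  by apply: (mulfI a0); apply/eqP; rewrite mulrN -addr_eq0; apply/eqP; rewrite -[RHS]e5; ring.
have two (r : k) : r + r = 0 by rewrite -mulr2n -mulr_natr (pcharf0 char2) mulr0.
have z1 : a * a6 + a6 * a = 0 by rewrite (mulrC a6) two.
have z2 : v * v + w * w = 0 by rewrite vw mulrNN two.
have -> : c * a ^+ 2 = (c * a * a + a * a6 + a6 * a + v * v + w * w)
  - (a * a6 + a6 * a) - (v * v + w * w) by ring.
by rewrite z1 z2 e7 !subr0; ring.
Qed.

(** This is m + n = 0 for the m and n of [alal_leading], the last correction to the parameter. It
    comes from y beta = 0, multiplied by [ga X] to be read in e0 A e0. *)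
Lemma be_ga_second p0 p1 p2 p3 p4 p5 p6 p7 q0 q1 q2 q3 q4 q5 q6 q7 :
  be X' = \E[p0, p1, p2, p3, p4, p5, p6, p7] * be X ->
  ga X' = ga X * \E[q0, q1, q2, q3, q4, q5, q6, q7] ->
  p1 * q0 + p0 * q1 = 0.
Proof.
move=> bE gE; have [y5 [y6 [y7 yE]]] := y_leading bE gE.
have p00 := be_leading_neq0 bE.
have := congr1 ( *%R^~ (ga X)) (ybe X' ht).
rewrite mul0r yE bE mulrA EM // -mulrA EyX zeroX !simp0.
case/EXinj => e _; apply: (mulfI p00); rewrite mulr0 -[RHS]e; ring.
Qed.

(** Multiplying beta eta = alpha y alpha beta by [ga X] on the right moves it into e0 A e0; the
    coefficients of y, y al y and y al y al then give the three claims in the order f_0, g, f_1. *)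
Lemma be_et_leading p0 p1 p2 p3 p4 p5 p6 p7 q0 q1 q2 q3 q4 q5 q6 q7
    a v w a5 a6 a7 f g :
  be X' = \E[p0, p1, p2, p3, p4, p5, p6, p7] * be X ->
  ga X' = ga X * \E[q0, q1, q2, q3, q4, q5, q6, q7] ->
  al X' = \E[0, a, 0, v, w, a5, a6, a7] ->
  et X' = e1 X * horner_alg (et X) f + g *: (ga X * (al X * be X)) ->
  [/\ g = 0, f`_0 = 0 & f`_1 = a ^+ 2 * (p0 * q0)].
Proof.
move=> bE gE aE eE; have [y5 [y6 [y7 yE]]] := y_leading bE gE.
have p00 := be_leading_neq0 bE.
have := congr1 ( *%R^~ (ga X)) (beet X').
have -> : al X' * be X' * ga X' * al X' * be X' * ga X =
  al X' * (be X' * ga X') * al X' * be X' * ga X by rewrite !mulrA.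
have -> : be X' * et X' * ga X =
    \E[p0, p1, p2, p3, p4, p5, p6, p7] * (\E[f`_0, 0, 0, 0, g, f`_1, 0, 0] * (be X * ga X)).
  have key : be X * et X' = \E[f`_0, 0, 0, 0, g, f`_1, 0, 0] * be X.
    rewrite Ebe // !scale0r !addr0 eE mulrDr -scalerAr mulrA bee1 be_horner //.
    by rewrite (mulrA (be X) (ga X)) addrAC.
  by rewrite bE -(mulrA _ (be X)) key -!mulrA.
rewrite EyX yE bE aE (mulrA _ _ (be X)) !EM // -(mulrA _ (be X)) EyX !simp0.
case/EXinj => e2 _ e6 e7.
have f00 : f`_0 = 0 by apply: (mulfI p00); rewrite e2 mulr0.
have g0 : g = 0.
  by apply: (mulfI p00); rewrite mulr0 -[RHS]e6 f00 !simp0.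
by split=> //; apply: (mulfI p00); move: e7; rewrite f00 g0 !simp0 => ->; ring.
Qed.

Lemma et_power h (n : nat) : (e1 X * horner_alg (et X) (h * 'X)) ^+ n.+1 =
  et X ^+ n.+1 * horner_alg (et X) (h ^+ n.+1).
Proof.
have etH f : e1 X * horner_alg (et X) (f * 'X) = horner_alg (et X) (f * 'X).
  by rewrite mulrC rmorphM /= horner_algX mulrA e1et.
by rewrite etH -rmorphXn exprMn mulrC rmorphM rmorphXn /= horner_algX.
Qed.

Lemma two_presentations : exists x,
  [/\ x != 0, x = x ^+ (5 * (t - 1)) & c = c' * x ^+ 2].
Proof.
have [a [u [v [w [a5 [a6 [a7 aE]]]]]]] := al_leading.
have [p [p0 [p1 [p2 [p3 [p4 [p5 [p6 [p7 ->]]]]]]]] bE] := be_leading.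
have [q [q0 [q1 [q2 [q3 [q4 [q5 [q6 [q7 ->]]]]]]]] gE] := ga_leading.
have p00 := be_leading_neq0 bE; have q00 := ga_leading_neq0 gE.
have [y5 [y6 [y7 yE]]] := y_leading bE gE.
have a0 := al_leading_neq0 aE yE.
have [u0 ax cE] := alal_leading aE yE; rewrite u0 in aE.
have mn := be_ga_second bE gE.
have := peirce11 spanX (et X'); rewrite -ee1 e1et ete1 ee1 => -[f [g eE]].
have [g0 f00 f1] := be_et_leading bE gE aE eE.
have x0 : p0 * q0 != 0 by rewrite mulf_neq0.
exists (p0 * q0); split=> //; last first.
  by apply: (mulfI (expf_neq0 2 a0)); rewrite mulrC cE mn; ring.
set x := p0 * q0 in x0 ax f1 *.
have [h fE] : exists h, f = h * 'X.
  elim/poly_ind: f f00 {eE f1} => [|f b _]; first by exists 0; rewrite mul0r.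
  by rewrite coefD coefMX coefC /= add0r => ->; exists f; rewrite addr0.
(* In gamma beta = eta^(t-1) the left side is x et^(t-1) plus a multiple of et^t, the coefficient of
   ga al be being m + n = 0. On the right the leading coefficient is f_1^(t-1), with f_1 = a^2 x =
   x^5. *)
have := gabe X'; rewrite gE bE !mulrA -(mulrA (ga X)) EM // -mulrA Ebe //.
rewrite eE fE g0 scale0r addr0 (t_sub1 ht) et_power -(t_sub1 ht) etX_horner //.
rewrite !mulrDr -!scalerAr gabe (mulrA _ (be X) (et X)) gabe -exprSr.
rewrite (mulrA (ga X) (be X * ga X)) gay // mul0r scaler0 addr0.
rewrite (_ : q0 * p1 + q1 * p0 = 0) ?scale0r ?addr0; last first.
  by rewrite -[RHS]mn; ring.
rewrite (_ : (t - 1).+1 = t); last by rewrite subn1 prednK // (leq_trans _ ht).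
have h0 : (h ^+ (t - 1))`_0 = x ^+ (5 * (t - 1)).
  rewrite -horner_coef0 horner_exp horner_coef0.
  by move: f1; rewrite fE coefMX /= ax => ->; rewrite exprM; congr (_ ^+ _); ring.
have swap (V : zmodType) (r1 r2 r3 r4 : V) :
    r1 + r2 = r3 + r4 -> r1 - r3 = r4 - r2.
  by move=> e; apply/eqP; rewrite subr_eq addrAC (addrC r4) -e addrK.
rewrite h0 mulrC -/x => /swap; rewrite -!scalerBl => /etXfree/eqP.
by rewrite subr_eq0 => /eqP.
Qed.

End TwoPresentations.

(** * Rescaling and Frobenius twists *)

Section Images.
Variables (k : fieldType) (t : nat) (c : k) (B C : algType k).
Variables (X : rep2B t c B) (phi : {lrmorphism B -> C}).

Lemma rep2B_image : exists Y : rep2B t c C,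
  (e0 Y = phi (e0 X) /\ e1 Y = phi (e1 X)) /\
  [/\ al Y = phi (al X), be Y = phi (be X), ga Y = phi (ga X) &
      et Y = phi (et X)].
Proof.
simple refine (let Y := @Rep2B k t c C (phi (e0 X)) (phi (e1 X)) (phi (al X))
  (phi (be X)) (phi (ga X)) (phi (et X)) _ _ _ _ _ _ _ _ _ _ _ _ _ _ _ _ _ _ in _);
  last by exists Y.
all: rewrite -?rmorphM ?e00 ?e11 ?e01 ?e10 ?e0al ?ale0 ?e0be ?bee1 ?e1ga ?gae0
  ?e1et ?ete1 ?rmorph0 //.
- by rewrite -rmorphD e0De1 rmorph1.
- by rewrite gabe rmorphXn.
- by rewrite beet.
- by rewrite etga.
- by rewrite alal rmorphD /= linearZ /= rmorphXn.
- by rewrite alalbe rmorph0.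
Qed.

Lemma horner_alg_image (x : B) f : phi (horner_alg x f) = horner_alg (phi x) f.
Proof.
elim/poly_ind: f => [|f a IH]; first by rewrite !rmorph0.
rewrite rmorphD rmorphM /= horner_algX horner_algC rmorphD rmorphM /= linearZ /= IH rmorph1.
by rewrite rmorphD rmorphM /= horner_algX horner_algC.
Qed.

Lemma in_span_image (Y : rep2B t c C) x :
  e0 Y = phi (e0 X) -> e1 Y = phi (e1 X) -> al Y = phi (al X) ->
  be Y = phi (be X) -> ga Y = phi (ga X) -> et Y = phi (et X) ->
  in_span X x -> in_span Y (phi x).
Proof.
move=> h0 h1 ha hb hg he.
have cornerP w : in_corner X w -> in_corner Y (phi w).
  move=> [a0 [a1 [a2 [a3 [a4 [a5 [a6 [a7 ->]]]]]]]].
  exists a0, a1, a2, a3, a4, a5, a6, a7.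
  exact: (E_map (esym h0) (esym ha) (esym hb) (esym hg)).
move=> [w [p [q [f [u [cw cp cq ->]]]]]].
exists (phi w), (phi p), (phi q), f, u; split; try exact: cornerP.
rewrite !rmorphD /= linearZ /= !rmorphM /= horner_alg_image.
by rewrite h1 ha hb hg he.
Qed.

End Images.

Section Scaling.
Variables (k : fieldType) (t : nat) (c d b : k) (B : algType k).
Variables (X : rep2B t c B).

(** With weights 1, 2 and 5 for [be], [al] and [et], all relations are homogeneous but two: the term
    in the parameter produces the factor b^2, and gamma beta = eta^(t-1) the condition on b. Only
    the product of the factors of [be] and [ga] matters, so [ga] is kept. *)
Lemma rep2B_scale : c = d * b ^+ 2 -> b = b ^+ (5 * (t - 1)) ->
  exists Y : rep2B t d B,
  (e0 Y = e0 X /\ e1 Y = e1 X) /\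
  [/\ al Y = b ^+ 2 *: al X, be Y = b *: be X, ga Y = ga X &
      et Y = b ^+ 5 *: et X].
Proof.
move=> cE bE.
simple refine (let Y := @Rep2B k t d B (e0 X) (e1 X) (b ^+ 2 *: al X) (b *: be X)
  (ga X) (b ^+ 5 *: et X) _ _ _ _ _ _ _ _ _ _ _ _ _ _ _ _ _ _ in _);
  last by exists Y.
all: rewrite -?scalerAl -?scalerAr ?e00 ?e11 ?e01 ?e10 ?e0al ?ale0 ?e0be ?bee1
  ?e1ga ?gae0 ?e1et ?ete1 ?e0De1 //.
- by rewrite gabe exprZn -exprM -bE.
- by rewrite beet -!(scalerAl, scalerAr) !scalerA; congr (_ *: _); ring.
- by rewrite etga -!(scalerAl, scalerAr) !scalerA; congr (_ *: _); ring.
- rewrite alal -!(scalerAl, scalerAr) !scalerA scalerDr !exprZn !scalerA.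
  by congr (_ *: _ + _ *: _); rewrite ?cE; ring.
- by rewrite -!(scalerAl, scalerAr) alalbe !scaler0.
Qed.

End Scaling.

Lemma image_comm (R S : nzRingType) (f : {rmorphism R -> S}) a b g :
  injective f -> f a * (f b * f g) = f b * f g * f a -> a * (b * g) = b * g * a.
Proof. by move=> fI; rewrite -!rmorphM => /fI. Qed.

Lemma comp_scale (k : fieldType) (B C D : algType k) (phi : {lrmorphism B -> C})
    (psi : {lrmorphism C -> D}) x y z l m :
  phi x = l *: y -> psi y = m *: z -> l * m = 1 -> psi (phi x) = z.
Proof. by move=> -> yz lm; rewrite linearZ /= yz scalerA lm scale1r. Qed.

Section ScalingIso.
Variables (k : fieldType) (t : nat) (ht : (3 <= t)%N).
Local Notation A := (Q2B k 2 t (leqnn 2) ht).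

Lemma Q2B_scaling_iso c d b : b != 0 -> c = d * b ^+ 2 ->
  b = b ^+ (5 * (t - 1)) -> algebra_isomorphic (A c) (A d).
Proof.
move=> b0 cE bE.
have [Y [[Y0 Y1] [Ya Yb Yg Ye]]] := rep2B_scale (Q2B_rep ht c) cE bE.
have dE : d = c * b^-1 ^+ 2 by rewrite cE exprVn mulfK // expf_neq0.
have bE' : b^-1 = b^-1 ^+ (5 * (t - 1)) by rewrite exprVn -bE.
have [Z [[Z0 Z1] [Za Zb Zg Ze]]] := rep2B_scale (Q2B_rep ht d) dE bE'.
have [phi [[f0 f1] [fa fb fg fe]]] := Q2B_lift ht Y.
have [psi [[g0 g1] [ga gb gg ge]]] := Q2B_lift ht Z.
have bb n : b^-1 ^+ n * b ^+ n = 1 by rewrite exprVn mulVf // expf_neq0.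
have bb' n : b ^+ n * b^-1 ^+ n = 1 by rewrite mulrC bb.
move: ga gb ge fa fb fe; rewrite Ya Yb Ye Za Zb Ze => ga gb ge fa fb fe.
exists psi; exists phi => x.
- apply: (@Q2B_endo_id k t ht c (phi \o psi)).
  + exact: etrans (congr1 phi (etrans g0 Z0)) (etrans f0 Y0).
  + exact: etrans (congr1 phi (etrans g1 Z1)) (etrans f1 Y1).
  + exact: comp_scale ga fa (bb 2).
  + exact: comp_scale gb fb (bb 1%N).
  + exact: etrans (congr1 phi (etrans gg Zg)) (etrans fg Yg).
  + exact: comp_scale ge fe (bb 5).
- apply: (@Q2B_endo_id k t ht d (psi \o phi)).
  + exact: etrans (congr1 psi (etrans f0 Y0)) (etrans g0 Z0).
  + exact: etrans (congr1 psi (etrans f1 Y1)) (etrans g1 Z1).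
  + exact: comp_scale fa ga (bb' 2).
  + exact: comp_scale fb gb (bb' 1%N).
  + exact: etrans (congr1 psi (etrans fg Yg)) (etrans gg Zg).
  + exact: comp_scale fe ge (bb' 5).
Qed.

End ScalingIso.

Lemma basic_idempotents_transport (k : fieldType) (I : finType) (A B : algType k)
    (e : I -> A) (rho : I -> {rmorphism A -> k}) (f : {lrmorphism A -> B}) :
  bijective f -> basic_idempotents e rho ->
  exists tau : I -> {rmorphism B -> k}, basic_idempotents (f \o e) tau.
Proof.
move=> /alg_iso_bij_inv[g [fK gK]] [ee e1 re el].
exists (fun i => rho i \o g); split=> [i j||i j|i x rx] /=.
- by rewrite -rmorphM ee; case: eqP; rewrite ?rmorph0.
- by rewrite -rmorph_sum e1 rmorph1.
- by rewrite fK re.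
have [y yE] := el _ _ rx; exists (f y).
by rewrite -[x in f _ * (_ * x * _)]gK -!rmorphM yE.
Qed.

Lemma E_aly (k : fieldType) (t : nat) (c : k) (B : algType k) (X : rep2B t c B) :
  E X 0 0 0 1 0 0 0 0 = al X * (be X * ga X).
Proof. by rewrite EE !scale0r !addr0 !add0r scale1r. Qed.

Lemma E_yal (k : fieldType) (t : nat) (c : k) (B : algType k) (X : rep2B t c B) :
  E X 0 0 0 0 1 0 0 0 = be X * ga X * al X.
Proof. by rewrite EE !scale0r !addr0 !add0r scale1r. Qed.

Section Comparison.
Variables (k : fieldType) (t : nat) (ht : (3 <= t)%N) (c d : k).
Hypothesis char2 : 2%N \in [pchar k].
Local Notation A := (Q2B k 2 t (leqnn 2) ht).
Local Notation X := (Q2B_rep ht).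

Lemma Q2B_iso_compare (f : {lrmorphism A c -> A d}) (s : bool -> bool) :
  bijective f -> bijective s ->
  (forall v, f (vertex_idem (X c) (s v)) = vertex_idem (X d) v) ->
  exists x, [/\ x != 0, x = x ^+ (5 * (t - 1)) & d = c * x ^+ 2].
Proof.
move=> bf bs fe.
have [Y [[Y0 Y1] [Ya Yb Yg Ye]]] := rep2B_image (X c) f.
have [g fK gK] := bf.
have spanY u : in_span Y u.
  rewrite -(gK u); apply: (in_span_image Y0 Y1 Ya Yb Yg Ye); exact: Q2B_span.
have spanX u : in_span (X d) u by exact: Q2B_span.
have [s1|s1] : s false = false /\ s true = true \/ s false = true /\ s true = false.
  have : s true <> s false by move/(bij_inj bs).
  by case: (s true) (s false) => [] [] //; [left | right].
- apply: (two_presentations ht char2 _ _ spanX spanY).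
  + by rewrite Y0; have := fe false; rewrite s1.1.
  + by rewrite Y1; have := fe true; rewrite s1.2.
  + exact: E_inj.
  + exact: etX_sub1_free.
(* If [s] swaps the vertices, the images of alpha and y lie in the commutative corner e1 A e1, so
   alpha y = y alpha already in the first algebra, against the independence of these two
   monomials. *)
have e01 : e0 Y = e1 (X d) by rewrite Y0; have := fe true; rewrite s1.2.
have : al Y * (be Y * ga Y) = be Y * ga Y * al Y.
  apply: (peirce11_comm ht spanX); rewrite -e01.
    by rewrite e0al ale0.
  by rewrite mulrA e0be -mulrA gae0.
rewrite Ya Yb Yg => /(image_comm (can_inj fK)) e.
by case/E_inj: (etrans (E_aly _) (etrans e (esym (E_yal _)))) => /eqP; rewrite oner_eq0.
Qed.

End Comparison.

(** With [sigma] the Frobenius, this twist acts through powers and so undoes [frobenius_twist],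
    which acts through roots; morphisms into the two twists compose to linear maps. *)
Definition scalar_twist (k : fieldType) (sigma : {rmorphism k -> k})
  (A : algType k) : Type := A.

Section ScalarTwist.
Variables (k : fieldType) (sigma : {rmorphism k -> k}) (A : algType k).
Local Notation scalar_twist := (scalar_twist sigma A).

HB.instance Definition _ := GRing.NzRing.on scalar_twist.
HB.instance Definition _ := GRing.Zmodule_isLmodule.Build k scalar_twist
  (@restrict_scaleA k k sigma A) (@restrict_scale1 k k sigma A)
  (@restrict_scaleDr k k sigma A) (@restrict_scaleDl k k sigma A).

Lemma scalar_twistE (a : k) (x : scalar_twist) : a *: x = sigma a *: (x : A).
Proof. by []. Qed.

Lemma scalar_twistAl (a : k) (x y : scalar_twist) : a *: (x * y) = (a *: x) * y.
Proof. exact: (scalerAl (sigma a) (x : A) y). Qed.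
Lemma scalar_twistAr (a : k) (x y : scalar_twist) : a *: (x * y) = x * (a *: y).
Proof. exact: (scalerAr (sigma a) (x : A) y). Qed.

HB.instance Definition _ :=
  GRing.Lmodule_isLalgebra.Build k scalar_twist scalar_twistAl.
HB.instance Definition _ :=
  GRing.Lalgebra_isAlgebra.Build k scalar_twist scalar_twistAr.

End ScalarTwist.

Lemma pack_lrmorphism (k : fieldType) (A B : algType k)
    (f : A -> B) : linear f -> monoid_morphism f ->
  exists h : {lrmorphism A -> B}, h =1 f.
Proof.
move=> f_lin f_mul.
pose fL := GRing.isLinear.Build k A B _ f f_lin.
pose fM := GRing.isMonoidMorphism.Build A B f f_mul.
by pose h : {lrmorphism A -> B} := HB.pack f fL fM; exists h.
Qed.

Section FrobeniusInverse.
Variables (k : closedFieldType) (chark : 2%N \in [pchar k]).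
Variables (A B : algType k).
Local Notation T := (frobenius_twist chark 1).
Local Notation S := (scalar_twist (pFrobenius_aut chark)).

Lemma frobenius_root_sq (a : k) : frobenius_root chark 1 (a ^+ 2) = a.
Proof. by apply: (@frobenius_pow_inj _ _ chark 1); rewrite frobenius_rootK. Qed.

Lemma twist_comp (C : algType k) (f : {lrmorphism A -> T B})
    (g : {lrmorphism B -> S C}) :
  exists h : {lrmorphism A -> C}, forall x, h x = g (f x).
Proof.
apply: (@pack_lrmorphism k A C (fun x => g (f x))) => [a x y|].
  rewrite linearP [g _](linearP g); congr (_ + _).
  rewrite [LHS]scalar_twistE /= pFrobenius_autE.
  by rewrite -[in RHS](frobenius_rootK chark 1 a).
split=> [|x y]; first by rewrite (rmorph1 f) (rmorph1 g).
by rewrite (rmorphM f) (rmorphM g).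
Qed.

Lemma comp_twist (C : algType k) (f : {lrmorphism A -> S B})
    (g : {lrmorphism B -> T C}) :
  exists h : {lrmorphism A -> C}, forall x, h x = g (f x).
Proof.
apply: (@pack_lrmorphism k A C (fun x => g (f x))) => [a x y|].
  rewrite linearP [g _](linearP g); congr (_ + _).
  rewrite -[LHS]/(frobenius_root chark 1 (pFrobenius_aut chark a) *: (g (f x) : C)).
  by rewrite pFrobenius_autE frobenius_root_sq.
split=> [|x y]; first by rewrite (rmorph1 f) (rmorph1 g).
by rewrite (rmorphM f) (rmorphM g).
Qed.

Lemma twist_morphism (C : algType k) (f : {lrmorphism A -> C}) :
  exists h : {lrmorphism T A -> T C}, h =1 f.
Proof.
apply: (@pack_lrmorphism k (T A) (T C) f) => [a x y|].
  exact: (linearP f).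
by split=> [|x y]; [exact: (rmorph1 f) | exact: (rmorphM f)].
Qed.

Lemma twist_isomorphic (C : algType k) :
  algebra_isomorphic A C -> algebra_isomorphic (T A) (T C).
Proof.
case=> f [g fK gK]; have [h hE] := twist_morphism f.
by exists h, g => x; rewrite hE ?fK ?gK.
Qed.

End FrobeniusInverse.

(** Only the relation for alpha^2 contains a scalar. In the twist c^2 acts as its root c, so the
    unchanged generators of A_c satisfy the relations of A_(c^2). The opposite twist yields the
    inverse in the same way. *)
Lemma Q2B_morita_twist (k : closedFieldType) (chark : 2%N \in [pchar k]) t
    (ht : (3 <= t)%N) (c : k) :
  exists psi : {lrmorphism Q2B k 2 t (leqnn 2) ht (c ^+ 2) ->
                           frobenius_twist chark 1 (Q2B k 2 t (leqnn 2) ht c)},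
    bijective psi /\
    forall v, psi (vertex_idem (Q2B_rep ht (c ^+ 2)) v) =
      vertex_idem (Q2B_rep ht c) v.
Proof.
set A := Q2B k 2 t (leqnn 2) ht; set T := frobenius_twist chark 1 (A c).
have rootK : frobenius_root chark 1 (c ^+ 2) = c.
  by apply: (@frobenius_pow_inj _ _ chark 1); rewrite frobenius_rootK.
pose X := Q2B_rep ht c; pose X2 := Q2B_rep ht (c ^+ 2).
have alalT : al X * al X = be X * ga X * al X * be X * ga X
    + (c ^+ 2) *: ((be X * ga X * al X : T) ^+ 2) :> T.
  rewrite -[_ *: _ in RHS]/(frobenius_root chark 1 (c ^+ 2) *: ((be X * ga X * al X) ^+ 2)).
  by rewrite rootK -alal.
pose Y : rep2B t (c ^+ 2) T := @Rep2B k t (c ^+ 2) T (e0 X) (e1 X) (al X) (be X)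
  (ga X) (et X) (e00 X) (e11 X) (e01 X) (e10 X) (e0De1 X) (e0al X) (ale0 X)
  (e0be X) (bee1 X) (e1ga X) (gae0 X) (e1et X) (ete1 X) (gabe X) (beet X)
  (etga X) alalT (alalbe X).
have [psi [[f0 f1] [fa fb fg fe]]] := Q2B_lift ht Y.
pose S := scalar_twist (pFrobenius_aut chark) (A (c ^+ 2)).
have alalS : al X2 * al X2 = be X2 * ga X2 * al X2 * be X2 * ga X2
    + c *: ((be X2 * ga X2 * al X2 : S) ^+ 2) :> S.
  rewrite -[_ *: _ in RHS]/(pFrobenius_aut chark c *: ((be X2 * ga X2 * al X2) ^+ 2)).
  by rewrite pFrobenius_autE -alal.
pose Z : rep2B t c S := @Rep2B k t c S (e0 X2) (e1 X2) (al X2) (be X2)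
  (ga X2) (et X2) (e00 X2) (e11 X2) (e01 X2) (e10 X2) (e0De1 X2) (e0al X2)
  (ale0 X2) (e0be X2) (bee1 X2) (e1ga X2) (gae0 X2) (e1et X2) (ete1 X2)
  (gabe X2) (beet X2) (etga X2) alalS (alalbe X2).
have [chi [[g0 g1] [ga_ gb gg ge]]] := Q2B_lift ht Z.
have [h hE] := twist_comp psi chi; have [h' h'E] := comp_twist chi psi.
exists psi; split; last by case; [exact: f1 | exact: f0].
exists chi => x.
- rewrite -hE; apply: Q2B_endo_id; rewrite hE.
  + exact: etrans (congr1 chi f0) g0.
  + exact: etrans (congr1 chi f1) g1.
  + exact: etrans (congr1 chi fa) ga_.
  + exact: etrans (congr1 chi fb) gb.
  + exact: etrans (congr1 chi fg) gg.
  + exact: etrans (congr1 chi fe) ge.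
- rewrite -h'E; apply: Q2B_endo_id; rewrite h'E.
  + exact: etrans (congr1 psi g0) f0.
  + exact: etrans (congr1 psi g1) f1.
  + exact: etrans (congr1 psi ga_) fa.
  + exact: etrans (congr1 psi gb) fb.
  + exact: etrans (congr1 psi gg) fg.
  + exact: etrans (congr1 psi ge) fe.
Qed.

Lemma Q2B_morita_compare (k : closedFieldType) (chark : 2%N \in [pchar k]) t
    (ht : (3 <= t)%N) (c : k) :
  morita_equivalent (Q2B k 2 t (leqnn 2) ht c)
    (frobenius_twist chark 1 (Q2B k 2 t (leqnn 2) ht c)) ->
  exists x, [/\ x != 0, x = x ^+ (5 * (t - 1)) & c ^+ 2 = c * x ^+ 2].
Proof.
move=> [F [G [FG GF]]].
have [psi [bpsi psiE]] := Q2B_morita_twist chark ht c.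
have [rho eP] := Q2B_basic ht c; have [rho2 e2P] := Q2B_basic ht (c ^+ 2).
have [tau fP] := basic_idempotents_transport bpsi e2P.
have [Theta [s [bT bs sE]]] := morita_basic_equiv eP fP FG GF.
have [g [psiK gK]] := alg_iso_bij_inv bpsi.
apply: (Q2B_iso_compare chark (f := g \o Theta) (s := s)) => //.
  by apply: bij_comp bT; exists psi.
by move=> v; rewrite [LHS](congr1 g (sE v)); exact: psiK.
Qed.

Theorem proposition4p4
    (k : closedFieldType) (iota : {rmorphism 'F_2 -> k})
    (hk : forall x : k, algebraicOver iota x)
    (n : nat) (hn : (4 <= n)%N) (c : k) :
  is_morita_frobenius_number (pchar2_of_F2 iota)
    (Q2B k 2 (2 ^ (n - 2)) (leqnn 2) (exp2_sub2_ge3 hn) c) 1 <->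
  exists c' : 'F_2,
    algebra_isomorphic
      (Q2B k 2 (2 ^ (n - 2)) (leqnn 2) (exp2_sub2_ge3 hn) c)
      (Q2B k 2 (2 ^ (n - 2)) (leqnn 2) (exp2_sub2_ge3 hn) (iota c')).
Proof.
set chark := pchar2_of_F2 iota; set ht := exp2_sub2_ge3 hn.
split=> [[_ /Q2B_morita_compare[x [x0 xE cE]] _]|[c' Ac]].
  have [->|c0] := eqVneq c 0.
    by exists 0; rewrite rmorph0; exists idfun; exists id.
  (* Cancelling c in c^2 = c x^2 leaves c = x^2; together with x = x^(5(t-1)) this allows the
     rescaling from parameter c to parameter 1. *)
  have c1 : c = iota 1 * x ^+ 2.
    by rewrite rmorph1 mul1r; apply: (mulfI c0); rewrite -cE.
  by exists 1; exact: (Q2B_scaling_iso ht x0 c1 xE).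
split=> [//||[|j] //].
apply: algebra_isomorphic_morita.
(* Elements of F_2 are their own squares, so A_(c') is isomorphic to its twist. The chain of
   isomorphisms runs from A_c to A_(c'), to the twist of A_(c'), to the twist of A_c. *)
have twist : algebra_isomorphic (Q2B k 2 (2 ^ (n - 2)) (leqnn 2) ht (iota c'))
    (frobenius_twist chark 1 (Q2B k 2 (2 ^ (n - 2)) (leqnn 2) ht (iota c'))).
  have [psi [bpsi _]] := Q2B_morita_twist chark ht (iota c').
  have : algebra_isomorphic (Q2B k 2 (2 ^ (n - 2)) (leqnn 2) ht (iota c' ^+ 2))
    (frobenius_twist chark 1 (Q2B k 2 (2 ^ (n - 2)) (leqnn 2) ht (iota c'))).
    by exists psi.
  suff -> : iota c' ^+ 2 = iota c' by [].
  by rewrite -rmorphXn; congr (iota _); case: c' {Ac psi bpsi} => [[|[|]]] // i;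
    apply: val_inj.
apply: (algebra_isomorphic_trans Ac).
apply: (algebra_isomorphic_trans twist).
exact/twist_isomorphic/algebra_isomorphic_sym.
Qed.
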